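(* Let $G:\mathbb{R}_+\to\mathbb{R}_+$ be a right-continuous kernel with $G(0)>0$. (1) Assume that $G$ is locally integrable and has a resolvent of the first kind $R$, and that $R$ is nonincreasing. Then $G$ preserves nonnegativity. (2) Assume that $G$ is nonincreasing. Then $G$ preserves nonnegativity if and only if its resolvent of the first kind $R$ is nonincreasing. Besides, in this case, $$R(ds)=\frac{1}{G(0)}\delta_0(ds)+r(s)\,ds,$$ where $r:\mathbb{R}_+^*\to\mathbb{R}_+$ is a locally integrable nonincreasing function.
   Context: Notation: $\mathbb{R}_+=[0,\infty)$, $\mathbb{R}_+^*=(0,\infty)$, $\mathbb{N}^*=\{1,2,\dots\}$; $\delta_0$ is the Dirac mass at $0$. Nonnegativity preserving kernel: a function (kernel) $G:\mathbb{R}_+\to\mathbb{R}_+$ with $G(0)>0$ is said to preserve nonnegativity if, for any $K\in\mathbb{N}^*$, any $x_1,\dots,x_K\in\mathbb{R}$ and any $0\le t_1<\dots<t_K$ such that $\sum_{k'=1}^k x_{k'}G(t_k-t_{k'})\ge 0$ for all $k\in\{1,\dots,K\}$, one has $\sum_{k:\,t_k\le t}x_kG(t-t_k)\ge 0$ for all $t\ge 0$ (an empty sum is $0$). Resolvent of the first kind: for a nonnegative measurable locally integrable kernel $G:\mathbb{R}_+\to\mathbb{R}_+$, a resolvent of the first kind of $G$ is a signed Borel measure $R$ on $\mathbb{R}_+$ with locally bounded total variation (i.e. $|R|([0,t])<\infty$ for all $t>0$) such that $\int_{[0,t]}G(t-s)R(ds)=1$ for all $t\ge 0$. Such a resolvent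 need not exist, but is unique when it exists. It is a known fact that when $G$ is nonincreasing and not identically zero, the resolvent exists and is a nonnegative measure. Nonincreasing measure: a real-valued measure $M$ on $\mathbb{R}_+$ with locally bounded total variation is said to be nonincreasing if for any $0\le h_1\le h_2$, $M(h_1+ds)-M(h_2+ds)$ is a nonnegative measure on $\mathbb{R}_+$, where $M(h+ds)$ is the image of $M$ under $s\mapsto s-h$ (restricted to $\mathbb{R}_+$); that is, $M(h_1+A)\ge M(h_2+A)$ for every bounded Borel set $A\subset\mathbb{R}_+$. *)

(* Defs.v *)
From HB Require Import structures.
From mathcomp Require Import all_boot all_order all_algebra.
From mathcomp Require Import all_classical all_reals all_analysis.

Set Implicit Arguments.
Unset Strict Implicit.
Unset Printing Implicit Defensive.

Import Order.TTheory GRing.Theory Num.Theory.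
Import numFieldNormedType.Exports.

Local Open Scope classical_set_scope.
Local Open Scope ring_scope.

(* A function on [0, +oo[ is represented by a function R -> R, of which only
   the values at arguments >= 0 are ever used. *)

Definition preserves_nonnegativity (R : realType) (G : R -> R) : Prop :=
  forall (K : nat) (x t : 'I_K -> R),
    (0 < K)%N ->
    (forall i, 0 <= t i) ->
    (forall i j : 'I_K, (i < j)%N -> t i < t j) ->
    (forall k : 'I_K, 0 <= \sum_(j < K | (j <= k)%N) x j * G (t k - t j)) ->
    forall s : R, 0 <= s -> 0 <= \sum_(k < K | t k <= s) x k * G (s - t k).

Definition locally_integrable_on_nonneg (R : realType) (G : R -> R) : Prop :=
  forall T : R, 0 <= T -> lebesgue_measure.-integrable `[0, T] (EFin \o G).

Definition agrees_with_charge (R : realType) (M : set R -> R)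
    (nu : {charge set (measurableTypeR R) -> \bar R}) (D : set R) : Prop :=
  forall A : set (measurableTypeR R),
    measurable A -> A `<=` D -> (M A)%:E = nu A.

(* A signed Borel measure on [0, +oo[ with locally bounded total variation need
   not extend to a finite charge on the whole half-line, so it is represented by
   its values M A on the bounded Borel sets A `<=` [0, +oo[ (the other values
   of M are irrelevant). On each [0, T], M has to coincide with a charge;
   charges are finite-valued, so the variation of M on [0, T] is finite. *)
Definition locally_bounded_measure (R : realType) (M : set R -> R) : Prop :=
  forall T : R, 0 <= T ->
    exists nu : {charge set (measurableTypeR R) -> \bar R},
      agrees_with_charge M nu `[0, T].

(* The integral of f over D against M exists (absolutely) and equals v. Neither
   v nor the integrability depends on the charge nu extending M from D, or on
   the Hahn decomposition (P, N) of nu. *)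
Definition has_integral (R : realType) (M : set R -> R) (D : set R)
    (f : R -> R) (v : R) : Prop :=
  exists (nu : {charge set (measurableTypeR R) -> \bar R})
         (P N : set (measurableTypeR R)) (nuPN : hahn_decomposition nu P N),
    [/\ agrees_with_charge M nu D,
        (charge_variation nuPN).-integrable D (EFin \o f) &
        v = Rintegral (jordan_pos nuPN) D f - Rintegral (jordan_neg nuPN) D f].

Definition resolvent_first_kind (R : realType) (G : R -> R) (M : set R -> R) :
    Prop :=
  locally_bounded_measure M /\
  forall t : R, 0 <= t -> has_integral M `[0, t] (fun s => G (t - s)) 1.

Definition nonincreasing_measure (R : realType) (M : set R -> R) : Prop :=
  forall h1 h2 : R, 0 <= h1 -> h1 <= h2 ->
  forall A : set (measurableTypeR R),
    measurable A -> A `<=` `[0, +oo[ -> bounded_set (A : set R) ->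
    M [set h2 + a | a in A] <= M [set h1 + a | a in A].

(* r is only meaningful on ]0, +oo[, where it may be unbounded near 0; the
   density r(s) ds is that of a locally finite measure on [0, +oo[, whence
   integrability on ]0, T]. *)
Definition dirac_plus_nonincreasing_density (R : realType) (c : R)
    (M : set R -> R) : Prop :=
  exists r : R -> R,
    [/\ forall s, 0 < s -> 0 <= r s,
        forall s t, 0 < s -> s <= t -> r t <= r s,
        forall T : R, 0 < T ->
          lebesgue_measure.-integrable `]0, T] (EFin \o r) &
        forall A : set (measurableTypeR R),
          measurable A -> A `<=` `[0, +oo[ -> bounded_set (A : set R) ->
          ((M A)%:E = c%:E * dirac (0%R : measurableTypeR R) A +
            \int[lebesgue_measure]_(s in A `&` `]0%R, +oo[) (r s)%:E)%E].

(* Main.v *)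
From HB Require Import structures.
Require Import Defs.
From mathcomp Require Import all_boot all_order all_algebra.
From mathcomp Require Import all_classical all_reals all_analysis.
From mathcomp Require Import measurable_realfun.
From mathcomp Require Import ring lra.
Import Order.TTheory GRing.Theory Num.Theory.
Import numFieldNormedType.Exports.
Local Open Scope classical_set_scope.
Local Open Scope ring_scope.

(* Let m(t) = R([0, t]), so that (G * m)(t) = t_+.

   A nonincreasing resolvent preserves nonnegativity: put
   f(s) = sum_k x_k G(s - t_k) and let [a, b[ be a gap between consecutive t_k
   such that f >= 0 on [0, a]. On [a, b] the function f * m is affine. The part
   of f before a is nonnegative and m has nonincreasing increments, so the
   convolution H of m with the part q of f after a is convex; since H(0) = 0 and
   f(a) >= 0, also H >= 0, so H, extended by 0 to the left, stays convex. Hence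
   G * H = q * (G * m) is convex; it is a second antiderivative of q, so q >= 0.

   Conversely, for G nonincreasing and nonnegativity preserving, choose masses
   x_k at the grid points k d so that f(0) = 1 and f(k d) = 0 for k > 0. Then
   f >= 0, x_k <= 0 for k > 0, the partial sums of the x_k are nonnegative, and
   the mass of f outside [0, d[ is at most d (1 - G(d)/G(0)). Therefore
   (f * m)(t + d) / d = sum_k x_k (t + d - k d)_+ / d, which is concave and
   nondecreasing in t, converges to m(t) as d tends to 0. So m is concave and
   nondecreasing, and its right derivative is the density.

   Existence of R for G nonincreasing: R = (1/G(0)) sum_n nu^{*n}, where nu is
   the measure -dG/G(0). *)

(** The resolvent enters only through its distribution function [m]: convolving an integrable
    function with a bounded one takes little more than Fubini, while [R] itself may be signed.
    Kernel and resolvent are only locally finite, so both are cut to a window [[0, T]], and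
    identities are claimed for times up to [T] only.

    On a gap [f * m] is affine because each mass [x_k] contributes [x_k (t - t_k)_+]. Nothing is
    differentiated: a negative value of [q] would, by right continuity, make a small second
    difference of [q * t_+] negative, against convexity.

    In the converse, [f] equals [G / G(0)] on [[0, d[], so it is close to 1 there, and almost
    nothing follows: [f / d] is an approximate Dirac mass. Taken at [t + d] rather than at [t], the
    convolution averages [m] over []t, t + d]], so that right continuity of [m] gives the limit. The
    mass outside [[0, d[] is small compared with [d] because [G] is right-continuous at 0. *)

(** * Convolution of integrable functions with bounded ones *)

Section convolution.
Context {R : realType}.
Notation mu := (@lebesgue_measure R).
Implicit Types f g b : R -> R.

Definition L1 f := mu.-integrable setT (EFin \o f).

Definition bounded_measurable b :=
  measurable_fun setT b /\ exists B : R, forall x, `|b x| <= B.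

(** The integral runs over the whole line: the functions convolved later vanish on the negatives, so
    no limits of integration have to be tracked. With [f] integrable and [b] bounded it exists at
    every [t], not just almost everywhere. *)
Definition conv f b (t : R) : R := \int[mu]_s (f s * b (t - s)).

Lemma L1_measurable f : L1 f -> measurable_fun setT f.
Proof. by move=> /integrableP[/measurable_EFinP]. Qed.

Lemma bounded_measurable_ge0 b :
  bounded_measurable b -> exists2 B : R, 0 <= B & forall x, `|b x| <= B.
Proof. by case=> mb [B Bb]; exists B => //; exact: le_trans (Bb 0). Qed.

Lemma L1M f b : L1 f -> bounded_measurable b -> L1 (fun s => f s * b s).
Proof.
move=> f1 [mb [B Bb]]; rewrite /L1.
have -> : EFin \o (fun s => f s * b s) = ((EFin \o f) \* (EFin \o b))%E.
  by apply/funext => s /=; rewrite EFinM.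
apply: integrableMl => //.
exists B; split; first by rewrite num_real.
by move=> M BM x _ /=; apply: le_trans (Bb x) (ltW BM).
Qed.

Lemma measurable_shift (c : R) : measurable_fun setT (fun x : R => x + c).
Proof. exact: measurable_funD. Qed.

Lemma measurable_reflect (c : R) : measurable_fun setT (fun x : R => c - x).
Proof. exact: measurable_funB. Qed.

(** Uniqueness of Lebesgue measure reduces translation invariance to half-open intervals. *)
Lemma lebesgue_measure_shift (c : R) (A : set (measurableTypeR R)) :
  measurable A -> pushforward mu (fun x : R => x + c : measurableTypeR R) A = mu A.
Proof.
move=> mA; apply/esym/lebesgue_measure_unique => //=; first exact: measurable_shift.
move=> mf _ [[a b]] _ <-; rewrite /pushforward/=.
have -> : (fun x : R => x + c) @^-1` `]a, b] = `]a - c, b - c]%classic.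
  by apply/seteqP; split => x /=; rewrite !in_itv/= ltrBlDr lerBrDr.
rewrite !lebesgue_measure_itv/= !lte_fin ltrD2r.
by case: ifP => // _; congr (_%:E); ring.
Qed.

Lemma ge0_integral_shift (c : R) (f : R -> \bar R) :
  measurable_fun setT f -> (forall x, 0 <= f x)%E ->
  (\int[mu]_x f (x + c)%R = \int[mu]_x f x)%E.
Proof.
move=> mf f0.
have := @ge0_integral_pushforward _ _ (measurableTypeR R) (measurableTypeR R) R _
  (measurable_shift c) mu setT f measurableT mf (fun x _ => f0 x).
rewrite preimage_setT => <-; apply: eq_measure_integral.
  exact: measurable_shift.
by move=> ms A mA _; exact: lebesgue_measure_shift.
Qed.

Lemma L1_shift (c : R) f : L1 f -> L1 (fun x => f (x + c)).
Proof.
move=> /integrableP[mf fi]; apply/integrableP; split.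
  apply: measurableT_comp => //; apply: measurableT_comp (measurable_shift c).
  exact/measurable_EFinP.
by rewrite (ge0_integral_shift c (fun x => `|(f x)%:E|%E)) //; exact: measurableT_comp.
Qed.

Lemma Rintegral_shift (c : R) f : L1 f ->
  \int[mu]_x f (x + c) = \int[mu]_x f x.
Proof.
move=> f1; rewrite /Rintegral; congr fine.
have mf : measurable_fun setT (EFin \o f) by case/integrableP: f1.
rewrite integralE [RHS]integralE; congr (_ - _)%E.
  rewrite -[RHS](ge0_integral_shift c _ (measurable_funepos mf) (funepos_ge0 _)).
  by apply: eq_integral => x _; rewrite !funeposE.
rewrite -[RHS](ge0_integral_shift c _ (measurable_funeneg mf) (funeneg_ge0 _)).
by apply: eq_integral => x _; rewrite !funenegE.
Qed.

Lemma bounded_measurable_reflect (c : R) b : bounded_measurable b ->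
  bounded_measurable (fun x => b (c - x)).
Proof.
move=> [mb [B Bb]]; split; last by exists B.
exact: measurableT_comp mb (measurable_reflect c).
Qed.

Lemma conv_L1 f b t : L1 f -> bounded_measurable b -> L1 (fun s => f s * b (t - s)).
Proof. by move=> f1 bb; apply: L1M => //; exact: bounded_measurable_reflect. Qed.

(** Lets convolutions be iterated. Measurability in [t] is Tonelli for the positive and negative
    parts of the integrand on the plane. *)
Lemma conv_bounded_measurable f b : L1 f -> bounded_measurable b ->
  bounded_measurable (conv f b).
Proof.
move=> f1 bb; have [B B0 Bb] := bounded_measurable_ge0 _ bb.
have mb : measurable_fun setT b by case: bb.
have mf := L1_measurable _ f1.
split; last first.
  exists (\int[mu]_s (`|f s| * B)) => t.
  apply: le_trans (le_normr_Rintegral _ _) _ => //; first exact: conv_L1.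
  apply: le_Rintegral => //.
  - exact/integrable_norm/conv_L1.
  - apply: (L1M (fun s => `|f s|) (cst B)); first exact: (integrable_norm f1).
    by split => //; exists B => x /=; rewrite ger0_norm.
  - by move=> s _; rewrite normrM ler_wpM2l.
pose F (z : R * R) := (f z.2 * b (z.1 - z.2))%:E.
have mF : measurable_fun setT F.
  apply/measurable_EFinP; apply: measurable_funM.
    exact: measurableT_comp mf _.
  apply: measurableT_comp mb _; exact: measurable_funB.
have -> : conv f b = fine \o (fun t => \int[mu]_s F^\+ (t, s) - \int[mu]_s F^\- (t, s))%E.
  apply/funext => t /=; rewrite /conv /Rintegral [in LHS]integralE.
  congr (fine (_ - _)); apply: eq_integral => s _; rewrite ?funeposE ?funenegE//.
apply: measurableT_comp; first exact: fine_measurable.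
apply: emeasurable_funB.
  apply: (measurable_fun_fubini_tonelli_F (m2 := mu) F^\+%E) => //.
  exact: measurable_funepos.
apply: (measurable_fun_fubini_tonelli_F (m2 := mu) F^\-%E) => //.
exact: measurable_funeneg.
Qed.

(** Stands in for associativity and commutativity, without forming [f * g]. *)
Lemma convCA f g b t : L1 f -> L1 g -> bounded_measurable b ->
  conv f (conv g b) t = conv g (conv f b) t.
Proof.
move=> f1 g1 bb; have [B B0 Bb] := bounded_measurable_ge0 _ bb.
have mb : measurable_fun setT b by case: bb.
have mf := L1_measurable _ f1; have mg := L1_measurable _ g1.
pose F (z : R * R) := (f z.1 * (g z.2 * b (t - z.1 - z.2)))%:E.
have mF : measurable_fun setT F.
  apply/measurable_EFinP; apply: measurable_funM.
    exact: measurableT_comp mf _.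
  apply: measurable_funM; first exact: measurableT_comp mg _.
  apply: measurableT_comp mb _; apply: measurable_funB => //.
  exact: measurable_funB.
(* Bounding [b] by [B] leaves the product of the two [L1] norms and [B], which is finite. *)
have iF : (mu \x mu)%E.-integrable setT F.
  apply/(integrable12ltyP mu mu mF).
  have mag : measurable_fun setT (fun y : R => `|g y|%:E)%E.
    by apply/measurable_EFinP; exact: measurableT_comp.
  have maf : measurable_fun setT (fun y : R => `|f y|%:E)%E.
    by apply/measurable_EFinP; exact: measurableT_comp.
  apply: (@le_lt_trans _ _ (\int[mu]_x (`|f x|%:E * (B%:E * \int[mu]_y `|g y|%:E)))%E).
    apply: ge0_le_integral => //.
    - by move=> x _; apply: integral_ge0.
    - apply: (measurable_fun_fubini_tonelli_F (m2 := mu) (fun z => `|F z|)%E) => //.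
      exact: measurableT_comp.
    - by apply: emeasurable_funM => //; exact: measurable_cst.
    - move=> x _.
      have Z (k : R) (h : R -> \bar R) : 0 <= k -> measurable_fun setT h ->
          (forall y, 0 <= h y)%E -> (k%:E * \int[mu]_y h y = \int[mu]_y (k%:E * h y))%E.
        by move=> k0 mh h0; rewrite ge0_integralZl.
      rewrite (Z B)// Z//; last 2 first.
      - by apply: emeasurable_funM => //; exact: measurable_cst.
      - by move=> y; rewrite mule_ge0// lee_fin.
      apply: ge0_le_integral => //.
      - apply: measurableT_comp => //; exact: measurableT_comp.
      - apply: emeasurable_funM; first exact: measurable_cst.
        by apply: emeasurable_funM => //; exact: measurable_cst.
      - move=> y _; rewrite /F/= lee_fin !normrM ler_wpM2l// mulrC.
        by rewrite ler_wpM2r.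
  rewrite ge0_integralZr//; last first.
    by rewrite mule_ge0 ?lee_fin// integral_ge0.
  rewrite lte_mul_pinfty//.
  - by apply: integral_ge0.
  - apply/fin_numPlt/andP; split.
      by apply: lt_le_trans (integral_ge0 _ _) => //; rewrite ltNyr.
    by case/integrableP: f1.
  - rewrite lte_mul_pinfty// ?lee_fin//.
    by case/integrableP: g1.
have E (h k : R -> R) : L1 h -> L1 k -> forall t,
    (\int[mu]_s (h s * conv k b (t - s))%:E =
    \int[mu]_s \int[mu]_u (h s * (k u * b (t - s - u)))%:E)%E.
  move=> h1 k1 t'; apply: eq_integral => s _.
  have k1' := conv_L1 k b (t' - s) k1 bb.
  under eq_integral do rewrite EFinM.
  rewrite integralZl// EFinM; congr (_ * _)%E.
  by rewrite /conv /Rintegral fineK//; exact: integrable_fin_num.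
rewrite /conv /Rintegral; congr fine.
rewrite -/(conv g b) -/(conv f b) (E f g)// (E g f)//.
rewrite (Fubini iF) /F/=.
apply: eq_integral => s _; apply: eq_integral => u _; congr (_%:E).
by rewrite mulrCA; congr (_ * (_ * b _)); ring.
Qed.

End convolution.

Section convolution_calculus.
Context {R : realType}.
Notation mu := (@lebesgue_measure R).
Implicit Types f g b : R -> R.

Lemma L1D f g : L1 f -> L1 g -> L1 (fun x => f x + g x).
Proof.
move=> f1 g1; have := integrableD measurableT f1 g1.
by apply: eq_integrable => // x _.
Qed.

Lemma L1Z (c : R) f : L1 f -> L1 (fun x => c * f x).
Proof.
move=> f1; have := integrableZl measurableT c f1.
by apply: eq_integrable => // x _.
Qed.

Lemma L1_sum (I : Type) (r : seq I) (P : pred I) (F : I -> R -> R) :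
  (forall i, L1 (F i)) -> L1 (fun x => \sum_(i <- r | P i) F i x).
Proof.
move=> F1; elim: r => [|i r ih].
  rewrite (_ : (fun x => _) = fun=> 0); first exact: integrable0.
  by apply/funext => x; rewrite big_nil.
rewrite (_ : (fun x => _) = fun x => (if P i then F i x else 0) +
    \sum_(j <- r | P j) F j x); last first.
  by apply/funext => x; rewrite big_cons; case: ifP => //; rewrite add0r.
apply: L1D => //; case: (P i) => //; exact: integrable0.
Qed.

Lemma le_L1_Rintegral f g : L1 f -> L1 g -> (forall x, f x <= g x) ->
  \int[mu]_x f x <= \int[mu]_x g x.
Proof. by move=> f1 g1 fg; exact: le_Rintegral. Qed.

Lemma L1_Rintegral_ge0 f : (forall x, 0 <= f x) -> 0 <= \int[mu]_x f x.
Proof. by move=> f0; exact: Rintegral_ge0. Qed.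

Lemma bounded_measurable_indic (A : set R) :
  measurable A -> bounded_measurable (\1_A : R -> R).
Proof.
move=> mA; split; first exact: measurable_indic.
by exists 1 => x; rewrite indicE; case: (_ \in _); rewrite ?normr1 ?normr0.
Qed.

Lemma bounded_measurable_itv (i : interval R) :
  bounded_measurable (\1_[set` i] : R -> R).
Proof. by apply: bounded_measurable_indic; exact: measurable_itv. Qed.

Lemma L1_indic_itv (x y : R) : L1 (\1_`[x, y]).
Proof. exact: integrable_indic_itv. Qed.

Lemma Rintegral_indic_itv (c x y : R) : x <= y ->
  \int[mu]_s (c * \1_`[x, y] s) = c * (y - x).
Proof.
move=> xy; rewrite RintegralZl//; last exact: L1_indic_itv.
congr (_ * _); rewrite /Rintegral integral_indic// setIT/= lebesgue_measure_itv/=.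
rewrite lte_fin; case: ltP => // yx.
by rewrite (_ : y = x) ?subrr//; apply/eqP; rewrite eq_le xy yx.
Qed.

Lemma Rintegral_supp1 (c : R) f : (forall x, x != c -> f x = 0) ->
  \int[mu]_x f x = 0.
Proof.
move=> f0; rewrite -[RHS](Rintegral_set1 f c) [RHS]Rintegral_mkcond.
apply: eq_Rintegral => x _; rewrite patchE; case: ifPn => // xc.
by apply: f0; apply: contra xc => /eqP ->; rewrite inE.
Qed.

Lemma conv_eq0 f b t : (forall s, f s * b (t - s) = 0) -> conv f b t = 0.
Proof. by move=> h; apply: (Rintegral_supp1 0) => s _; exact: h. Qed.

Lemma convDl f g b t : L1 f -> L1 g -> bounded_measurable b ->
  conv (fun s => f s + g s) b t = conv f b t + conv g b t.
Proof.
move=> f1 g1 bb; rewrite /conv -RintegralD//; try exact: conv_L1.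
by apply: eq_Rintegral => s _; rewrite mulrDl.
Qed.

Lemma convZl (c : R) f b t : L1 f -> bounded_measurable b ->
  conv (fun s => c * f s) b t = c * conv f b t.
Proof.
move=> f1 bb; rewrite /conv -RintegralZl//; try exact: conv_L1.
by apply: eq_Rintegral => s _; rewrite mulrA.
Qed.

Lemma conv_suml (I : Type) (r : seq I) (F : I -> R -> R) b t :
  (forall i, L1 (F i)) -> bounded_measurable b ->
  conv (fun s => \sum_(i <- r) F i s) b t = \sum_(i <- r) conv (F i) b t.
Proof.
move=> F1 bb; elim: r => [|i r ih].
  by rewrite big_nil; apply: conv_eq0 => s; rewrite big_nil mul0r.
rewrite big_cons -ih -convDl//; last exact: L1_sum.
by congr (conv _ b t); apply/funext => s; rewrite big_cons.
Qed.

Lemma conv_shiftl (c : R) f b t : L1 f -> bounded_measurable b ->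
  conv (fun s => f (s - c)) b t = conv f b (t - c).
Proof.
move=> f1 bb; rewrite /conv -[RHS](Rintegral_shift (- c)); last exact: conv_L1.
by apply: eq_Rintegral => s _; congr (_ * b _); ring.
Qed.

Lemma convB f b t u : L1 f -> bounded_measurable b ->
  conv f b t - conv f b u = \int[mu]_s (f s * (b (t - s) - b (u - s))).
Proof.
move=> f1 bb; rewrite /conv -RintegralB//; try exact: conv_L1.
by apply: eq_Rintegral => s _; rewrite mulrBr.
Qed.

Lemma L1_convB f b t u : L1 f -> bounded_measurable b ->
  L1 (fun s => f s * (b (t - s) - b (u - s))).
Proof.
move=> f1 bb.
rewrite (_ : (fun s => _) = fun s => f s * b (t - s) + -1 * (f s * b (u - s))).
  by apply: L1D; [|apply: L1Z]; exact: conv_L1.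
by apply/funext => s; ring.
Qed.

(** The second difference falls on [b] alone; this is how convexity of one factor passes to a
    convolution with a nonnegative one. *)
Lemma conv_diff2 f b t u v : L1 f -> bounded_measurable b ->
  (conv f b t - conv f b u) - (conv f b u - conv f b v) =
  \int[mu]_s (f s * ((b (t - s) - b (u - s)) - (b (u - s) - b (v - s)))).
Proof.
move=> f1 bb; rewrite !convB// -RintegralB//; try exact: L1_convB.
by apply: eq_Rintegral => s _; rewrite -mulrBr.
Qed.

Lemma L1_conv_diff2 f b t u v : L1 f -> bounded_measurable b ->
  L1 (fun s => f s * ((b (t - s) - b (u - s)) - (b (u - s) - b (v - s)))).
Proof.
move=> f1 bb.
rewrite (_ : (fun s => _) = fun s => f s * (b (t - s) - b (u - s)) +
    -1 * (f s * (b (u - s) - b (v - s)))).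
  by apply: L1D; [|apply: L1Z]; exact: L1_convB.
by apply/funext => s; ring.
Qed.

End convolution_calculus.

Definition right_continuous_at {R : realType} (f : R -> R) (s : R) :=
  forall e : R, 0 < e -> exists2 d : R, 0 < d &
    forall u : R, s <= u -> u < s + d -> `|f u - f s| < e.

(** * Nonincreasing resolvents *)

Section nonneg_extension.
Context {R : realType}.
Notation mu := (@lebesgue_measure R).
Variables (f g m : R -> R) (T a b al be : R).
Hypotheses (f1 : L1 f) (f_neg : forall x : R, x < 0 -> f x = 0).
Hypotheses (g1 : L1 g) (g_neg : forall x : R, x < 0 -> g x = 0).
Hypothesis g_ge0 : forall x, 0 <= g x.
Hypotheses (bm : bounded_measurable m) (m_neg : forall x : R, x < 0 -> m x = 0).
Hypothesis gm : forall t, t <= T -> conv g m t = Num.max t 0.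
Hypothesis m_near0 : exists2 d : R, 0 < d & forall u : R, 0 <= u -> u < d -> 0 <= m u.
Hypothesis m_incr : forall y y' e : R, 0 <= y -> y <= y' -> 0 <= e -> y' + e <= T ->
  m (y' + e) - m y' <= m (y + e) - m y.
Hypotheses (a0 : 0 <= a) (ab : a < b) (bT : b <= T).
Hypothesis f_ge0 : forall s : R, 0 <= s -> s < a -> 0 <= f s.
Hypothesis fa_ge0 : 0 <= f a.
Hypothesis f_rc : forall s : R, a <= s -> s < b -> right_continuous_at f s.
Hypothesis fm_affine :
  forall v : R, 0 <= v -> v <= b - a -> conv f m (a + v) = al + be * v.

(** Splitting at [a] separates the part [p] of known sign from the unknown part [q], moved so as to
    start at 0. No cut is made at [b]: by causality, times up to [b - a] only see [q] up to
    there. *)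
Let q (v : R) := f (v + a) * \1_`[0, +oo[ v.
Let p (u : R) := f u * \1_`]-oo, a[ u.
Let H := conv q m.

Let qE (v : R) : 0 <= v -> q v = f (v + a).
Proof. by move=> v0; rewrite /q indicE mem_set ?mulr1//= in_itv/= v0. Qed.

Let q_neg (v : R) : v < 0 -> q v = 0.
Proof.
by move=> v0; rewrite /q indicE memNset ?mulr0//= in_itv/= andbT; apply/negP; rewrite -ltNge.
Qed.

Let p_ge0 u : 0 <= p u.
Proof.
rewrite /p indicE; case: (boolP (u \in _)); rewrite ?mulr0 ?mulr1// inE/= in_itv/= => ua.
by have [u0|u0] := ltP u 0; [rewrite f_neg|exact: f_ge0].
Qed.

Let p_neg (u : R) : u < 0 -> p u = 0.
Proof. by move=> u0; rewrite /p f_neg// mul0r. Qed.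

Let p_ge (u : R) : a <= u -> p u = 0.
Proof.
by move=> au; rewrite /p indicE memNset ?mulr0//= in_itv/=; apply/negP; rewrite -leNgt.
Qed.

Let q1 : L1 q.
Proof.
apply: L1M; first exact: L1_shift.
exact: bounded_measurable_itv.
Qed.

Let p1 : L1 p.
Proof. by apply: L1M => //; exact: bounded_measurable_itv. Qed.

Let fm_split v : conv f m (a + v) = conv p m (a + v) + H v.
Proof.
rewrite (_ : H v = conv (fun s => q (s - a)) m (a + v)); last first.
  by rewrite conv_shiftl//; congr conv; ring.
rewrite -convDl//; last exact: L1_shift.
congr (conv _ m _); apply/funext => s.
rewrite /p /q subrK -mulrDr [X in _ * X](_ : _ = 1) ?mulr1// !indicE.
have [sa|as_] := ltP s a.
  by rewrite mem_set ?memNset ?addr0//= in_itv/= ?sa ?andbT// subr_ge0; apply/negP; rewrite -ltNge.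
by rewrite memNset ?mem_set ?add0r//= in_itv/= ?subr_ge0 ?as_//; apply/negP; rewrite -leNgt.
Qed.

Let H_neg (v : R) : v < 0 -> H v = 0.
Proof.
move=> v0; apply: conv_eq0 => s; have [s0|s0] := ltP s 0; first by rewrite q_neg ?mul0r.
by rewrite m_neg ?mulr0//; lra.
Qed.

Let H0 : H 0 = 0.
Proof.
apply: (Rintegral_supp1 0) => s s0; have [sn|sn] := ltP s 0.
  by rewrite q_neg ?mul0r.
by rewrite m_neg ?mulr0// sub0r oppr_lt0 lt_neqAle eq_sym s0.
Qed.

(** As [f * m] is affine on the gap, an increment of [H] is [be * e] minus one of [p * m]; the
    latter decreases in time since [p] is nonnegative and [m] has nonincreasing increments. *)
Let H_incr (v v' e : R) : 0 <= v -> v <= v' -> 0 <= e -> v' + e <= b - a ->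
  H (v + e) - H v <= H (v' + e) - H v'.
Proof.
move=> v0 vv' e0 v'e.
have E (w : R) : 0 <= w -> w + e <= b - a ->
    H (w + e) - H w = be * e - (conv p m (a + (w + e)) - conv p m (a + w)).
  move=> w0 we; have := fm_split (w + e); have := fm_split w.
  by rewrite !fm_affine; lra.
have ve : v + e <= b - a by apply: le_trans v'e; rewrite lerD2r.
have v'0 : 0 <= v' by exact: le_trans vv'.
rewrite (E v)// (E v')//.
rewrite lerD2l lerN2 !convB//.
apply: le_L1_Rintegral; try exact: L1_convB.
move=> s; have [s0|s0] := ltP s 0; first by rewrite p_neg// !mul0r.
(* On the support of [p] the argument [a + v - s] is positive, so [m_incr] is never applied across
   the jump of [m] at 0. *)
have [sa|sa] := ltP s a; last by rewrite p_ge// !mul0r.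
apply: ler_wpM2l => //.
have -> : a + (v' + e) - s = (a + v' - s) + e by ring.
have -> : a + (v + e) - s = (a + v - s) + e by ring.
by apply: m_incr; have := bT; lra.
Qed.

(* The right derivative of H at 0 is nonnegative because f(a) and m(0+) are. *)
Let H_low (k : R) : 0 < k -> exists2 d : R, 0 < d & forall y : R, 0 <= y -> y < d -> - k * y <= H y.
Proof.
move=> k0; have [B B0 Bm] := bounded_measurable_ge0 _ bm.
(* The factor [m <= B] turns [f >= - k / (B + 1)] into an integrand at least [- k]; the [+ 1] keeps
   the divisor positive. *)
have e0 : 0 < k / (B + 1) by rewrite divr_gt0//; lra.
have [d1 d10 hf] := f_rc a (lexx a) ab _ e0.
have [d2 d20 hm] := m_near0.
exists (Num.min d1 d2); first by rewrite lt_min d10.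
move=> y y0; rewrite lt_min => /andP[yd1 yd2].
have <- : \int[mu]_s (- k * \1_`[0, y] s) = - k * y.
  by rewrite Rintegral_indic_itv// subr0.
apply: le_L1_Rintegral.
- exact/L1Z/L1_indic_itv.
- exact: conv_L1.
move=> s; rewrite indicE.
have [s0|s0] := ltP s 0.
  by rewrite q_neg// mul0r memNset ?mulr0//= in_itv/= => /andP[]; lra.
have [ys|sy] := ltP y s.
  rewrite (m_neg (y - s)) ?mulr0 ?memNset ?mulr0//; last by lra.
  by rewrite /= in_itv/= => /andP[]; lra.
rewrite mem_set/= ?in_itv/= ?s0// mulr1 qE//.
have m0 : 0 <= m (y - s) by apply: hm; lra.
have mB := ler_normlW (Bm (y - s)).
have : `|f (s + a) - f a| < k / (B + 1) by apply: hf; lra.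
rewrite ltr_norml => /andP[fl _].
have {}fl : - (k / (B + 1)) <= f (s + a) by have := fa_ge0; lra.
apply: (@le_trans _ _ (- (k / (B + 1)) * m (y - s))); last exact: ler_wpM2r.
by rewrite mulNr lerN2 mulrAC ler_pdivrMr ?ler_pM2l //; lra.
Qed.

(** Convexity and [H 0 = 0] give [H e >= n * H (e / n)], and the linear lower bound of [H_low] at
    the small point [e / n] survives multiplication by [n]. Its slope is taken as half of that of
    the supposedly negative chord, which contradicts [H e < 0]. *)
Let H_ge0 (e : R) : 0 <= e -> e <= b - a -> 0 <= H e.
Proof.
rewrite le_eqVlt => /predU1P[<-|e0 eb]; first by rewrite H0.
rewrite leNgt; apply/negP => He.
have k0 : 0 < - H e / (2 * e) by rewrite divr_gt0// ?mulr_gt0//; lra.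
have [d d0 hd] := H_low _ k0.
have [n n0 nd] : exists2 n : nat, (0 < n)%N & e / n%:R < d.
  exists (Num.bound (e / d)).+1 => //.
  rewrite ltr_pdivrMr ?ltr0n// mulrC -ltr_pdivrMr//.
  apply: lt_le_trans (archi_boundP _) _; first by rewrite divr_ge0 ?ltW.
  by rewrite ler_nat.
have nR : 0 < n%:R :> R by rewrite ltr0n.
pose y := e / n%:R; have y0 : 0 < y by rewrite divr_gt0.
have ny : n%:R * y = e by rewrite /y mulrC divfK// gt_eqF.
have K k : (k <= n)%N -> k%:R * H y <= H (k%:R * y).
  elim: k => [|k ih] kn; first by rewrite !mul0r H0.
  have {}ih := ih (ltnW kn).
  have kye : k.+1%:R * y <= e by rewrite -ny ler_wpM2r ?ler_nat // ltW.
  have ky0 : 0 <= k%:R * y by rewrite mulr_ge0// ltW.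
  move: kye; rewrite -natr1 !mulrDl !mul1r => kye.
  have := H_incr 0 (k%:R * y) y (lexx _) ky0 (ltW y0) (le_trans kye eb).
  by rewrite add0r H0; lra.
have := K n (leqnn n); rewrite ny.
have := hd y (ltW y0) nd; rewrite -(ler_pM2l nR) => h1 h2.
have {h1 h2} : n%:R * (- (- H e / (2 * e)) * y) <= H e by exact: le_trans h1 h2.
rewrite mulrCA ny (_ : - (- H e / (2 * e)) * e = H e / 2); first by lra.
by field; rewrite gt_eqF.
Qed.

(** Convexity of the extension by 0 to the left; the cases are the positions of the three points
    relative to 0. *)
Let H_diff2 (x e : R) : 0 <= e -> x + 2 * e <= b - a ->
  0 <= (H (x + 2 * e) - H (x + e)) - (H (x + e) - H x).
Proof.
move=> e0 xe.
have [x0|x0] := leP 0 x.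
  have := H_incr x (x + e) e x0; rewrite (_ : x + e + e = x + 2 * e); last by ring.
  by move=> h; rewrite subr_ge0 h//; lra.
rewrite (H_neg x)//.
have [xe0|xe0] := leP (x + e) 0.
  have -> : H (x + e) = 0 by move: xe0; rewrite le_eqVlt => /predU1P[->//|/H_neg].
  rewrite !subr0; have [h|h] := ltP (x + 2 * e) 0; first by rewrite H_neg.
  exact: H_ge0.
(* With only [x] negative, [H (x + 2 * e) - H (x + e) >= H e >= H (x + e) + H (- x)], and the last
   term is nonnegative. *)
have h1 := H_incr 0 (x + e) e (lexx _) (ltW xe0) e0.
have h2 := H_incr 0 (x + e) (- x) (lexx _) (ltW xe0).
move: h1 h2; rewrite !add0r H0 !subr0.
rewrite (_ : x + e + e = x + 2 * e); last by ring.
rewrite (_ : x + e - x = e); last by ring.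
move=> /(_ xe) h1 h2; have {}h2 : H (- x) <= H e - H (x + e) by apply: h2; lra.
have h3 : 0 <= H (- x) by apply: H_ge0; lra.
by lra.
Qed.

(** By contradiction: just after a point [s] with [f s < 0], [f] stays below [f s / 2], which makes
    a second difference of [q * t_+] negative. The same quantity is a second difference of [g * H],
    nonnegative by [H_diff2]. *)
Lemma nonneg_extension (s : R) : a <= s -> s < b -> 0 <= f s.
Proof.
move=> as_ sb; rewrite leNgt; apply/negP => fs.
have k0 : 0 < - f s / 2 by lra.
have [d d0 hd] := f_rc s as_ sb _ k0.
(* The tent below has width [2 * e]; the factor 3 leaves room for the strict inequality in right
   continuity. *)
have [e [e0 e3d e3b]] : exists e : R, [/\ 0 < e, 3 * e <= d & 3 * e <= b - s].
  exists (Num.min d (b - s) / 3); rewrite [3 * _]mulrC divfK ?pnatr_eq0//.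
  rewrite !ge_min !lexx orbT; split => //.
  by rewrite divr_gt0// lt_min d0 subr_gt0.
have [v vE] : exists v : R, s = v + a by exists (s - a); rewrite subrK.
have v0 : 0 <= v by move: as_; rewrite vE lerDr.
have vb : v + 2 * e <= b - a by lra.
have vT : v + 2 * e <= T by have := bT; have := a0; lra.
(* The second difference of q * t_+ with step e is the integral of q against a
   tent function, which is at least e / 2 on the middle half of its support. *)
have int_lt0 : \int[mu]_u (- (- f s / 2 * (e / 2)) * \1_`[v + e / 2, v + 3 * e / 2] u) < 0.
  have -> : v + 3 * e / 2 = v + e / 2 + e by field.
  rewrite Rintegral_indic_itv; last by rewrite lerDl ltW.
  rewrite addrC addKr mulNr oppr_lt0; apply: mulr_gt0 => //; apply: mulr_gt0 => //.
  by rewrite divr_gt0.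
have bgm := conv_bounded_measurable _ _ g1 bm.
have bH := conv_bounded_measurable _ _ q1 bm.
have pos : 0 <= (conv g H (v + 2 * e) - conv g H (v + e)) - (conv g H (v + e) - conv g H v).
  rewrite conv_diff2//; apply: L1_Rintegral_ge0 => w.
  have [w0|w0] := ltP w 0; first by rewrite g_neg// mul0r.
  rewrite mulr_ge0//.
  have -> : v + 2 * e - w = (v - w) + 2 * e by ring.
  have -> : v + e - w = (v - w) + e by ring.
  apply: H_diff2; first exact: ltW.
  by apply: le_trans vb; rewrite lerD2r gerBl.
move: pos; apply/negP; rewrite -ltNge; apply: le_lt_trans int_lt0.
(* [H] is [q * m]; commuting moves [g] onto [m], where the product is known to be [t_+]. *)
have gH : conv g H =1 conv q (conv g m) by move=> t; exact: convCA.
rewrite !gH conv_diff2//; apply: le_L1_Rintegral.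
- exact: L1_conv_diff2.
- exact/L1Z/L1_indic_itv.
clear bgm bH gH.
move=> u; have [u0|u0] := ltP u 0.
  rewrite q_neg// mul0r indicE memNset ?mulr0//= in_itv/= => /andP[].
  by lra.
have -> : conv g m (v + 2 * e - u) = Num.max (v + 2 * e - u) 0 by apply: gm; lra.
have -> : conv g m (v + e - u) = Num.max (v + e - u) 0 by apply: gm; lra.
have -> : conv g m (v - u) = Num.max (v - u) 0 by apply: gm; lra.
have [uv|vu] := ltP u v.
  rewrite !max_l; [|lra..].
  rewrite indicE memNset ?mulr0; last by rewrite /= in_itv/= => /andP[]; lra.
  by rewrite (_ : _ - _ = 0) ?mulr0//; ring.
have [ue|ue] := ltP (v + 2 * e) u.
  rewrite !max_r; [|lra..].
  rewrite indicE memNset ?mulr0; last by rewrite /= in_itv/= => /andP[]; lra.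
  by rewrite !subrr mulr0.
rewrite (max_r (x := v - u)); last by lra.
rewrite (max_l (x := v + 2 * e - u)); last by lra.
rewrite qE//.
have qu : f (u + a) <= - (- f s / 2).
  have : `|f (u + a) - f s| < - f s / 2 by apply: hd; lra.
  by rewrite ltr_norml => /andP[_]; lra.
have tent_ge0 : 0 <= v + 2 * e - u - Num.max (v + e - u) 0 - (Num.max (v + e - u) 0 - 0).
  by have [|] := leP (v + e - u) 0; lra.
apply: (@le_trans _ _ (- (- f s / 2) *
    (v + 2 * e - u - Num.max (v + e - u) 0 - (Num.max (v + e - u) 0 - 0)))).
  exact: ler_wpM2r.
rewrite mulNr [leRHS]mulNr lerN2 -[leLHS]mulrA ler_wpM2l//; first exact: ltW.
rewrite indicE; case: (boolP (u \in _)); rewrite ?mulr0// inE/= in_itv/= => /andP[l1 l2].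
by have [|] := leP (v + e - u) 0; lra.
Qed.

End nonneg_extension.

(** * Jordan parts and distribution functions of the resolvent *)

Section jordan_parts.
Context {R : realType}.
Notation mu := (@lebesgue_measure R).
Notation BR := (measurableTypeR R).
Implicit Types nu : {charge set BR -> \bar R}.

(** Hahn decompositions of charges that agree on [D] may differ, but inside [D] a set positive for
    one and negative for the other is null for both. *)
Lemma jordan_agree nu nu' (P N P' N' : set BR) (nuPN : hahn_decomposition nu P N)
    (nuPN' : hahn_decomposition nu' P' N') (D A : set BR) :
  (forall B, measurable B -> B `<=` D -> nu B = nu' B) ->
  measurable A -> A `<=` D ->
  jordan_pos nuPN A = jordan_pos nuPN' A /\ jordan_neg nuPN A = jordan_neg nuPN' A.
Proof.
move=> E mA AD.
have [[mP pP] [mN nN] PNT PN0] := nuPN.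
have [[mP' pP'] [mN' nN'] PNT' PN0'] := nuPN'.
have Z1 : nu (A `&` P `&` N') = 0%E.
  apply/eqP; rewrite eq_le; apply/andP; split.
    rewrite E; last by move=> x [[/AD]].
      by apply: nN'; [apply: measurableI => //; exact: measurableI|move=> x []].
    by apply: measurableI => //; exact: measurableI.
  by apply: pP; [apply: measurableI => //; exact: measurableI|move=> x [[]]].
have Z2 : nu (A `&` N `&` P') = 0%E.
  apply/eqP; rewrite eq_le; apply/andP; split.
    by apply: nN; [apply: measurableI => //; exact: measurableI|move=> x [[]]].
  rewrite E; last by move=> x [[/AD]].
    by apply: pP'; [apply: measurableI => //; exact: measurableI|move=> x []].
  by apply: measurableI => //; exact: measurableI.
have key : nu (A `&` P) = nu' (A `&` P') /\ nu (A `&` N) = nu' (A `&` N').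
  split.
    rewrite (charge_partition nu (measurableI _ _ mA mP) mP' mN' PNT' PN0') Z1 adde0.
    rewrite (charge_partition nu' (measurableI _ _ mA mP') mP mN PNT PN0).
    rewrite -[X in _ = (_ + X)%E]E; last by move=> x [[/AD]].
      by rewrite -E ?(setIAC _ P' N) ?Z2 ?adde0 ?(setIAC _ P P')//;
        [apply: measurableI => //; exact: measurableI|move=> x [[/AD]]].
    by apply: measurableI => //; exact: measurableI.
  rewrite (charge_partition nu (measurableI _ _ mA mN) mP' mN' PNT' PN0') Z2 add0e.
  rewrite (charge_partition nu' (measurableI _ _ mA mN') mP mN PNT PN0).
  rewrite -[X in _ = (X + _)%E]E; last by move=> x [[/AD]].
    by rewrite -E ?(setIAC _ N' P) ?Z1 ?add0e ?(setIAC _ N N')//;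
      [apply: measurableI => //; exact: measurableI|move=> x [[/AD]]].
  by apply: measurableI => //; exact: measurableI.
have [kP kN] := key.
rewrite !jordan_posE !cjordan_posE !jordan_negE !cjordan_negE /crestr0 mem_set// /crestr.
by rewrite kP kN.
Qed.

(** The definition supplies a separate charge for every [t]; here one pair of finite measures serves
    all [t] up to [T]. The negative part stands on the right so that only integrals of nonnegative
    functions occur. *)
Lemma resolvent_jordan (G : R -> R) (M : set R -> R) (T : R) :
  (forall t, 0 <= t -> 0 <= G t) -> 0 <= T -> resolvent_first_kind G M ->
  exists lap lan : {finite_measure set BR -> \bar R},
    (forall A : set BR, measurable A -> A `<=` `[0, T] -> (M A)%:E = (lap A - lan A)%E) /\
    (forall t : R, 0 <= t -> t <= T ->
      (\int[lan]_(s in `[0%R, t]) (G (t - s)%R)%:E)%E \is a fin_num /\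
      (\int[lap]_(s in `[0%R, t]) (G (t - s)%R)%:E =
       1 + \int[lan]_(s in `[0%R, t]) (G (t - s)%R)%:E)%E).
Proof.
move=> G0 T0 [lbM rM].
have [nu nuM] := lbM T T0.
have [P [N nuPN]] := Hahn_decomposition nu.
exists (jordan_pos nuPN), (jordan_neg nuPN); split.
  move=> A mA AT; rewrite nuM// (jordan_decomp nuPN mA).
  by rewrite /cadd/= cscaleN1.
move=> t t0 tT.
have [nu' [P' [N' [nuPN' [nuM' + E1]]]]] := rM t t0.
set f := fun s : BR => (G (t - s)%R)%:E.
rewrite [EFin \o _](_ : _ = f)// => fi.
have mD : measurable (`[0%R, t]%classic : set BR) by exact: measurable_itv.
have mf : measurable_fun (`[0%R, t]%classic : set BR) f by exact: measurable_int fi.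
have f0 (s : BR) : (`[0%R, t]%classic : set BR) s -> (0 <= f s)%E.
  by rewrite /= in_itv/= => /andP[_ st]; rewrite lee_fin G0// subr_ge0.
have agree (A : set BR) : measurable A -> A `<=` `[0, t] ->
    jordan_pos nuPN A = jordan_pos nuPN' A /\ jordan_neg nuPN A = jordan_neg nuPN' A.
  move=> mA At; apply: jordan_agree mA At => B mB Bt.
  rewrite -nuM'// nuM//; apply: subset_trans Bt _ => x /=.
  by rewrite !in_itv/= => /andP[-> /le_trans->].
have Ep : (\int[jordan_pos nuPN]_(s in `[0%R, t]) f s =
           \int[jordan_pos nuPN']_(s in `[0%R, t]) f s)%E.
  by apply: eq_measure_integral => A mA At; have [] := agree A mA At.
have En : (\int[jordan_neg nuPN]_(s in `[0%R, t]) f s =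
           \int[jordan_neg nuPN']_(s in `[0%R, t]) f s)%E.
  by apply: eq_measure_integral => A mA At; have [] := agree A mA At.
rewrite -/f Ep En.
(* The variation is the sum of the Jordan parts, so integrability against it makes both integrals
   finite; only then may the difference of their [fine] values be rearranged. *)
have [_] := integrableP _ _ _ fi.
rewrite (_ : integral _ _ _ = (\int[jordan_pos nuPN']_(s in `[0%R, t]) f s +
    \int[jordan_neg nuPN']_(s in `[0%R, t]) f s)%E); last first.
  transitivity (\int[measure_add (jordan_pos nuPN') (jordan_neg nuPN')]_(s in `[0%R, t]) f s)%E.
    under eq_integral.
      move=> s /set_mem sD; rewrite gee0_abs; last exact: f0.
      over.
    by apply: eq_measure_integral => A mA At; exact/esym/measure_addE.
  by rewrite ge0_integral_measure_add.
have Ip0 : (0 <= \int[jordan_pos nuPN']_(s in `[0%R, t]) f s)%E by exact: integral_ge0.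
have In0 : (0 <= \int[jordan_neg nuPN']_(s in `[0%R, t]) f s)%E by exact: integral_ge0.
move: E1; rewrite /Rintegral -/f.
move: Ip0 In0.
case: (\int[jordan_pos nuPN']_(s in `[0%R, t]) f s)%E => [x| |]//;
case: (\int[jordan_neg nuPN']_(s in `[0%R, t]) f s)%E => [y| |]//=.
move=> _ _ E1 _; split => //.
by rewrite -EFinD; congr (_%:E); lra.
Qed.

End jordan_parts.

Section restricted_cdf.
Context {R : realType}.
Notation mu := (@lebesgue_measure R).
Notation BR := (measurableTypeR R).
Variables (la : {finite_measure set BR -> \bar R}) (T : R).

(** The charge that represents [M] is tied to it only on [[0, T]], so mass elsewhere is discarded.
    The function is 0 before 0 and constant after [T], hence bounded. *)
Definition rcdf (y : R) : R := fine (la (`]-oo, y] `&` `[0, T])).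

Let mI (y : R) : measurable (`]-oo, y] `&` `[0, T] : set BR).
Proof. by apply: measurableI; exact: measurable_itv. Qed.

Lemma rcdfE y : (rcdf y)%:E = la (`]-oo, y] `&` `[0, T]).
Proof. by rewrite fineK// fin_num_measure. Qed.

Lemma rcdf_neg (y : R) : y < 0 -> rcdf y = 0.
Proof.
move=> y0; rewrite /rcdf (_ : _ `&` _ = set0) ?measure0//.
by apply/seteqP; split => // x /=; rewrite !in_itv/= => -[xy /andP[x0 _]]; lra.
Qed.

Lemma rcdf_ge0 y : 0 <= rcdf y.
Proof. by rewrite fine_ge0. Qed.

Lemma rcdf_nd : {homo rcdf : x y / x <= y}.
Proof.
move=> x y xy; rewrite -lee_fin !rcdfE; apply: le_measure; rewrite ?inE//.
by apply: setSI => z /=; rewrite !in_itv/= => /le_trans; exact.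
Qed.

Lemma rcdf_bounded_measurable : bounded_measurable rcdf.
Proof.
split; first by apply: nondecreasing_measurable => // x y; exact: rcdf_nd.
exists (fine (la setT)) => y; rewrite ger0_norm ?rcdf_ge0//.
by rewrite -lee_fin rcdfE fineK ?fin_num_measure//; apply: le_measure; rewrite ?inE.
Qed.

(** Continuity from above along [y + 1 / (n + 1)]; monotonicity extends the sequential limit to all
    [u] near [y]. *)
Lemma rcdf_right_continuous (y : R) : right_continuous_at rcdf y.
Proof.
move=> e e0.
pose F (n : nat) : set BR := `]-oo, y + n.+1%:R^-1] `&` `[0, T].
have mF n : measurable (F n) by exact: mI.
have capF : \bigcap_n F n = `]-oo, y] `&` `[0, T].
  apply/seteqP; split => x /=; last first.
    move=> [xy xT] n _; split => //=.
    move: xy; rewrite /= !in_itv/= => /le_trans; apply.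
    by rewrite lerDl invr_ge0.
  move=> h; split; last by have [] := h 0%N I.
  rewrite in_itv/=; apply/ler_addgt0Pr => d d0.
  have [n nd] : exists n : nat, n.+1%:R^-1 < d.
    exists (Num.bound d^-1); rewrite invf_plt ?posrE//.
    apply: lt_le_trans (archi_boundP _) _; first by rewrite invr_ge0 ltW.
    by rewrite ler_nat.
  have [/= + _] := h n I; rewrite in_itv/= => /le_trans; apply.
  by rewrite lerD2l ltW.
have : la \o F @ \oo --> (rcdf y)%:E.
  rewrite rcdfE -capF; apply: nonincreasing_cvg_mu => //.
  - by rewrite ltey_eq fin_num_measure.
  - by rewrite capF; exact: mI.
  - move=> m n mn; apply/subsetPset; apply: setSI => x /=; rewrite !in_itv/= => /le_trans; apply.
    by rewrite lerD2l lef_pV2 ?posrE// ler_nat.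
move=> /fine_cvgP[].
move=> _ /cvgrPdist_lt/(_ e e0)[N _ hN].
exists N.+1%:R^-1 => // u yu uN.
have := hN N (leqnn N); rewrite /= distrC.
rewrite -[fine _]/(rcdf _) ger0_norm ?subr_ge0; last by apply: rcdf_nd; rewrite lerDl.
apply: le_lt_trans; rewrite ger0_norm ?subr_ge0; last exact: rcdf_nd.
by rewrite lerD2r; apply: rcdf_nd; exact: ltW.
Qed.

(* Tonelli: the antiderivative of g * la is g * (distribution function of la). *)
Lemma rcdf_conv (g : R -> R) (t : R) : L1 g -> (forall x, 0 <= g x) ->
  measurable_fun setT
    (fun u : R => (\1_`]-oo, t] u)%:E * \int[la]_(s in `[0%R, T]) (g (u - s)%R)%:E)%E /\
  (\int[mu]_u ((\1_`]-oo, t] u)%:E * \int[la]_(s in `[0%R, T]) (g (u - s)%R)%:E) =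
   (conv g rcdf t)%:E)%E.
Proof.
move=> g1 g0; have mg := L1_measurable _ g1.
have mD : measurable (`[0, T]%classic : set BR) by exact: measurable_itv.
pose K (z : BR * BR) : \bar R :=
  (\1_`]-oo, t] z.1 * (g (z.1 - z.2) * \1_`[0, T] z.2))%:E.
have mind (i : interval R) : measurable_fun setT (\1_[set` i] : R -> R).
  by case: (@bounded_measurable_itv R i).
have mK : measurable_fun setT K.
  apply/measurable_EFinP; apply: measurable_funM.
    exact: measurableT_comp (mind _) _.
  apply: measurable_funM; last exact: measurableT_comp (mind _) _.
  apply: measurableT_comp mg _; exact: measurable_funB.
have K0 z : (0 <= K z)%E.
  by rewrite lee_fin !mulr_ge0// indicE.
have -> : (fun u : R => (\1_`]-oo, t] u)%:E * \int[la]_(s in `[0%R, T]) (g (u - s)%R)%:E)%E =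
    (fun u : R => \int[la]_s K (u, s))%E.
  apply/funext => u.
  rewrite -ge0_integralZl//; last 2 first.
  - apply: measurable_funTS; apply/measurable_EFinP.
    exact: measurableT_comp mg (measurable_reflect u).
  - by move=> s _; rewrite lee_fin.
  rewrite integral_mkcond; apply: eq_integral => s _; rewrite patchE /K/= indicE.
  by rewrite [\1_`[0, T] s]indicE; case: (s \in _); rewrite ?mulr1 ?mulr0// ?EFinM.
split; first exact: (measurable_fun_fubini_tonelli_F (m2 := la) K mK K0).
rewrite (fubini_tonelli (m1 := mu) (m2 := la) K mK K0).
(* Translating [u] by [s] turns [g (u - s)] into [g u] and the indicator into that of [s <= t - u],
   whose [la]-integral is the distribution function. *)
transitivity (\int[la]_s \int[mu]_u K ((u + s)%R, s))%E.
  apply: eq_integral => s _.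
  rewrite -[LHS](ge0_integral_shift s)//.
  exact: measurableT_comp mK _.
rewrite -(fubini_tonelli (m1 := mu) (m2 := la) (fun z => K ((z.1 + z.2)%R, z.2)))//; last first.
  apply: measurableT_comp mK _; apply/measurable_fun_pairP.
  by split; [exact: measurable_funD|exact: measurable_snd].
rewrite /conv /Rintegral fineK; last first.
  apply: integrable_fin_num => //; apply: conv_L1 => //; exact: rcdf_bounded_measurable.
apply: eq_integral => u _.
rewrite EFinM rcdfE -(setIT (_ `&` _)) -integral_indic//.
rewrite -ge0_integralZl//; last 2 first.
- by apply/measurable_EFinP; exact: measurable_indic.
- by rewrite lee_fin.
apply: eq_integral => s _; rewrite /K/= -EFinM addrK mulrCA; congr (_ * _)%:E.
rewrite !indicE in_setI; case: (s \in `[0, T]%classic); rewrite ?mulr0 ?andbF// mulr1 andbT.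
by congr (nat_of_bool _)%:R; apply/idP/idP; rewrite !inE/= !in_itv/= lerBrDl.
Qed.

End restricted_cdf.

Section resolvent_cdf.
Context {R : realType}.
Notation mu := (@lebesgue_measure R).
Notation BR := (measurableTypeR R).
Variables (G : R -> R) (M : set R -> R) (T : R).

(** Makes a locally integrable kernel integrable on the line; convolutions at times up to [T] do not
    see the cut. *)
Definition trunc u : R := G u * \1_`[0, T] u.

Lemma truncE u : 0 <= u -> u <= T -> trunc u = G u.
Proof. by move=> u0 uT; rewrite /trunc indicE mem_set ?mulr1//= in_itv/= u0. Qed.

Lemma trunc_neg (u : R) : u < 0 -> trunc u = 0.
Proof. by move=> u0; rewrite /trunc indicE memNset ?mulr0//= in_itv/= => /andP[]; lra. Qed.

Lemma trunc_ge0 u : (forall t, 0 <= t -> 0 <= G t) -> 0 <= trunc u.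
Proof.
move=> G0; rewrite /trunc indicE; case: (boolP (u \in _)); rewrite ?mulr0 ?mulr1//.
by rewrite inE/= in_itv/= => /andP[/G0].
Qed.

Lemma trunc_L1 : 0 <= T -> locally_integrable_on_nonneg G -> L1 trunc.
Proof.
move=> T0 /(_ T T0) /integrable_mkcond.
move=> /(_ (measurable_itv _)); apply: eq_integrable => // x _.
by rewrite patchE /trunc/= indicE; case: (x \in _); rewrite ?mulr1 ?mulr0.
Qed.

(** The resolvent equation integrated in time, part by part so that Tonelli applies. At time 0 the
    equation itself reads [G 0 * m 0 = 1]. *)
Lemma resolvent_cdf : 0 < T -> (forall t, 0 <= t -> 0 <= G t) -> 0 < G 0 ->
  locally_integrable_on_nonneg G -> resolvent_first_kind G M ->
  exists lap lan : {finite_measure set BR -> \bar R},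
    let m := fun y => rcdf lap T y - rcdf lan T y in
    [/\ forall A : set BR, measurable A -> A `<=` `[0, T] -> (M A)%:E = (lap A - lan A)%E,
        forall t, t <= T -> conv trunc m t = Num.max t 0 &
        m 0 = (G 0)^-1].
Proof.
move=> T0 G0 G00 Gi rM.
have [lap [lan [MA E]]] := resolvent_jordan _ _ _ G0 (ltW T0) rM.
exists lap, lan => m; split => //.
  move=> t tT; have g1 := trunc_L1 (ltW T0) Gi.
  have g0 u : 0 <= trunc u by exact: trunc_ge0.
  have [t0|t0] := ltP t 0.
    apply: conv_eq0 => s.
    have [s0|s0] := ltP s 0; first by rewrite trunc_neg// mul0r.
    by rewrite /m !rcdf_neg ?subrr ?mulr0//; lra.
  have inner (la : {finite_measure set BR -> \bar R}) u : u <= T ->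
      (\int[la]_(s in `[0%R, T]) (trunc (u - s)%R)%:E =
       \int[la]_(s in `[0%R, u]) (G (u - s)%R)%:E)%E.
    move=> uT; rewrite integral_mkcond [RHS]integral_mkcond; apply: eq_integral => s _.
    rewrite !patchE; case: ifPn; case: ifPn => //; rewrite ?notin_setE ?inE/= ?in_itv/=.
    - by move=> /andP[s0 su] _; rewrite truncE// ?subr_ge0//; lra.
    - move=> /negP + /andP[s0 sT]; rewrite s0/= -ltNge => us.
      by rewrite trunc_neg// subr_lt0.
    - by move=> /andP[s0 su] []; rewrite s0 (le_trans su uT).
  have [mp Ip] := rcdf_conv lap T trunc t g1 g0.
  have [mn In] := rcdf_conv lan T trunc t g1 g0.
  have bp := rcdf_bounded_measurable lap T; have bn := rcdf_bounded_measurable lan T.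
  have -> : conv trunc m t = conv trunc (rcdf lap T) t - conv trunc (rcdf lan T) t.
    rewrite /conv -RintegralB//; try exact: conv_L1.
    by apply: eq_Rintegral => s _; rewrite mulrBr.
  (* With the [lan] term moved across, all integrands are nonnegative and the two sides can be
     compared pointwise in [u]. *)
  apply/eqP; rewrite subr_eq -eqe EFinD -Ip -In.
  have ti : (t%:E = \int[mu]_u (\1_`[0%R, t] u)%:E)%E.
    rewrite integral_indic// setIT/= lebesgue_measure_itv/= lte_fin.
    by case: ltP => [_|t0']; rewrite ?sube0//; congr _%:E; lra.
  rewrite {1}ti -ge0_integralD//; last 2 first.
  - by apply/measurable_EFinP; case: (@bounded_measurable_itv R `[0, t]).
  - by move=> u _; rewrite mule_ge0 ?lee_fin ?integral_ge0// => s _; rewrite lee_fin.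
  apply/eqP; apply: eq_integral => u _.
  have [ut|ut] := leP u t; last first.
    have -> : \1_`]-oo, t] u = 0 :> R.
      by rewrite indicE memNset//= in_itv/=; apply/negP; rewrite -ltNge.
    have -> : \1_`[0, t] u = 0 :> R.
      by rewrite indicE memNset//= in_itv/=; apply/negP; rewrite negb_and -!ltNge ut orbT.
    by rewrite !mul0e add0e.
  rewrite ![\1_`]-oo, t] u]indicE mem_set/= ?in_itv//= !mul1e !inner ?(le_trans ut)//.
  have [u0|u0] := ltP u 0.
    rewrite indicE memNset/=; last by rewrite in_itv/= => /andP[]; lra.
    rewrite set_itv_ge ?integral_set0 ?add0e//.
    by rewrite bnd_simp -ltNge.
  by rewrite indicE mem_set/= ?in_itv/= ?u0//; have [_ ->] := E u u0 (le_trans ut tT).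
have [_] := E 0 (lexx _) (ltW T0); rewrite set_itv1.
have I1 (la : {finite_measure set BR -> \bar R}) :
    (\int[la]_(s in [set 0%R]) (G (0 - s)%R)%:E = (G 0 * rcdf la T 0)%:E)%E.
  rewrite EFinM rcdfE (_ : _ `&` _ = [set 0]); last first.
    apply/seteqP; split => x /=; rewrite !in_itv/=; first by move=> [x0 /andP[x0' _]]; lra.
    by move=> ->; rewrite lexx ltW.
  rewrite -integral_cst//; apply: eq_integral => s; rewrite inE => /= ->.
  by rewrite subr0.
rewrite !I1 -EFinD => -[] h.
apply: (mulfI (lt0r_neq0 G00)); rewrite mulfV ?gt_eqF// /m mulrBr; lra.
Qed.

End resolvent_cdf.

(** * Right continuity, sums of translated kernels, increments of [m] *)

Section right_continuity.
Context {R : realType}.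
Implicit Types f g : R -> R.

Lemma right_continuous_at_cvg f (t : R) :
  f s @[s --> t^'+] --> f t -> right_continuous_at f t.
Proof.
move=> /cvgrPdist_lt h e e0.
have /nbhs_ballP[d d0 hd] := h e e0.
exists d => // u tu ud; have [->|ut] := eqVneq u t; first by rewrite subrr normr0.
have tu' : t < u by rewrite lt_neqAle eq_sym ut.
rewrite distrC; apply: hd => //.
by rewrite /ball/= ltr0_norm ?subr_lt0//; lra.
Qed.

Lemma right_continuous_atD f g (t : R) :
  right_continuous_at f t -> right_continuous_at g t ->
  right_continuous_at (fun s => f s + g s) t.
Proof.
move=> hf hg e e0; have e2 : 0 < e / 2 by rewrite divr_gt0.
have [d d0 hd] := hf _ e2; have [d' d'0 hd'] := hg _ e2.
exists (Num.min d d'); first by rewrite lt_min d0.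
move=> u tu; rewrite -ltrBlDl lt_min !ltrBlDl => /andP[ud ud'].
rewrite (_ : _ - _ = (f u - f t) + (g u - g t)); last by ring.
by rewrite (le_lt_trans (ler_normD _ _))// (splitr e) ltrD// ?hd ?hd'.
Qed.

Lemma right_continuous_atZ (c : R) f (t : R) :
  right_continuous_at f t -> right_continuous_at (fun s => c * f s) t.
Proof.
move=> hf e e0; have e' : 0 < e / (`|c| + 1) by rewrite divr_gt0// ltr_wpDl.
have [d d0 hd] := hf _ e'; exists d => // u tu ud.
rewrite -mulrBr normrM; have := hd u tu ud; rewrite ltr_pdivlMr ?ltr_wpDl//.
by apply: le_lt_trans; rewrite mulrC ler_wpM2l// lerDl.
Qed.

Lemma right_continuous_at_sum (I : Type) (r : seq I) (F : I -> R -> R) (t : R) :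
  (forall i, right_continuous_at (F i) t) ->
  right_continuous_at (fun s => \sum_(i <- r) F i s) t.
Proof.
move=> h; elim: r => [|i r ih].
  by move=> e e0; exists 1 => // u _ _; rewrite !big_nil subrr normr0.
have := right_continuous_atD _ _ _ (h i) ih.
by congr right_continuous_at; apply/funext => s; rewrite big_cons.
Qed.

Lemma right_continuous_at_shift (c : R) f (t : R) :
  right_continuous_at f (t - c) -> right_continuous_at (fun s => f (s - c)) t.
Proof.
by move=> h e e0; have [d d0 hd] := h e e0; exists d => // u tu ud; apply: hd; lra.
Qed.

Lemma right_continuous_at_trunc (G : R -> R) (T u : R) :
  (forall t, 0 <= t -> right_continuous_at G t) -> u < T ->
  right_continuous_at (trunc G T) u.
Proof.
move=> Grc uT e e0; have [u0|u0] := ltP u 0.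
  exists (- u); first by rewrite oppr_gt0.
  by move=> v uv; rewrite subrr => v0; rewrite !trunc_neg// subrr normr0.
have [d d0 hd] := Grc u u0 e e0.
exists (Num.min d (T - u)); first by rewrite lt_min d0 subr_gt0.
move=> v uv; rewrite -ltrBlDl lt_min ltrBlDl ltrD2r => /andP[vd vT].
by rewrite !truncE ?hd// ?(le_trans u0)// ltW.
Qed.

End right_continuity.

Section point_masses.
Context {R : realType}.
Notation mu := (@lebesgue_measure R).
Variables (G m : R -> R) (T : R) (K : nat) (x t : 'I_K -> R).
Hypotheses (t_ge0 : forall i, 0 <= t i) (T0 : 0 <= T).
Hypothesis (Gi : locally_integrable_on_nonneg G).

(** The condition [t k <= s] is absorbed by [trunc], which vanishes on the negatives; what remains
    is a plain linear combination of translates. *)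
Definition massconv (s : R) := \sum_(k < K) x k * trunc G T (s - t k).

Lemma massconv_L1 : L1 massconv.
Proof. by apply: L1_sum => k; apply: L1Z; apply: L1_shift; exact: trunc_L1. Qed.

Lemma massconvE (s : R) : s <= T -> massconv s = \sum_(k < K | t k <= s) x k * G (s - t k).
Proof.
move=> sT; rewrite /massconv [RHS]big_mkcond/=; apply: eq_bigr => k _.
case: ifPn => ks; first by rewrite truncE ?subr_ge0//; have := t_ge0 k; lra.
by rewrite trunc_neg ?mulr0// subr_lt0 ltNge.
Qed.

Lemma massconv_neg (s : R) : s < 0 -> massconv s = 0.
Proof.
move=> s0; rewrite /massconv big1// => k _; rewrite trunc_neg ?mulr0//.
by have := t_ge0 k; lra.
Qed.

Lemma massconv_right_continuous (s : R) :
  (forall t, 0 <= t -> right_continuous_at G t) -> s < T ->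
  right_continuous_at massconv s.
Proof.
move=> Grc sT; apply: right_continuous_at_sum => k; apply: right_continuous_atZ.
apply: right_continuous_at_shift; apply: right_continuous_at_trunc => //.
by have := t_ge0 k; lra.
Qed.

Lemma conv_massconv (s : R) : bounded_measurable m ->
  (forall t, t <= T -> conv (trunc G T) m t = Num.max t 0) -> s <= T ->
  conv massconv m s = \sum_(k < K) x k * Num.max (s - t k) 0.
Proof.
move=> bm gm sT; have g1 := trunc_L1 G T T0 Gi.
rewrite conv_suml//; last by move=> k; apply: L1Z; exact: L1_shift.
apply: eq_bigr => k _; rewrite convZl//; last exact: L1_shift.
by rewrite conv_shiftl// gm//; have := t_ge0 k; lra.
Qed.

End point_masses.

Section cdf_difference.
Context {R : realType}.
Notation BR := (measurableTypeR R).
Variables (M : set R -> R) (T : R) (lap lan : {finite_measure set BR -> \bar R}).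
Hypothesis MA : forall A : set BR,
  measurable A -> A `<=` `[0, T] -> (M A)%:E = (lap A - lan A)%E.
Let m := fun y => rcdf lap T y - rcdf lan T y.

Lemma rcdf_itv (la : {finite_measure set BR -> \bar R}) (y z : R) :
  0 <= y -> y <= z -> z <= T -> la `]y, z]%classic = (rcdf la T z - rcdf la T y)%:E.
Proof.
move=> y0 yz zT; rewrite EFinB !rcdfE.
have -> : `]-oo, z] `&` `[0, T] = (`]-oo, y] `&` `[0, T]) `|` `]y, z] :> set BR.
  apply/seteqP; split => s /=; rewrite !in_itv/=.
    by move=> [sz /andP[s0 sT]]; have [sy|sy] := leP s y; [left; rewrite s0|right].
  move=> [[sy /andP[s0 sT]]|/andP[ys sz]]; first by rewrite s0 sT (le_trans sy yz).
  by rewrite sz (ltW (le_lt_trans y0 ys)) (le_trans sz zT).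
rewrite measureU/=.
- have E (a b : \bar R) : b \is a fin_num -> (a = b + a - b)%E.
    by move=> bfin; rewrite [(b + _)%E]addeC addeK.
  by apply: E; rewrite fin_num_measure//; apply: measurableI; exact: measurable_itv.
- by apply: measurableI; exact: measurable_itv.
- exact: measurable_itv.
- apply/seteqP; split => // s /=; rewrite !in_itv/= => -[[sy _] /andP[ys _]].
  by move: (lt_le_trans ys sy); rewrite ltxx.
Qed.

Lemma cdfB_itv (y z : R) : 0 <= y -> y <= z -> z <= T -> M `]y, z]%classic = m z - m y.
Proof.
move=> y0 yz zT; apply/eqP; rewrite -eqe MA; last 2 first.
- exact: measurable_itv.
- move=> s /=; rewrite !in_itv/= => /andP[ys sz].
  by rewrite (ltW (le_lt_trans y0 ys)) (le_trans sz zT).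
by rewrite !rcdf_itv// -EFinB; apply/eqP; congr (_%:E); rewrite /m; ring.
Qed.

Lemma cdfB_bounded_measurable : bounded_measurable m.
Proof.
have [m1 [B1 h1]] := rcdf_bounded_measurable lap T.
have [m2 [B2 h2]] := rcdf_bounded_measurable lan T.
split; first exact: measurable_funB.
exists (B1 + B2) => y; rewrite (le_trans (ler_normB _ _))// lerD//.
Qed.

Lemma cdfB_neg (y : R) : y < 0 -> m y = 0.
Proof. by move=> y0; rewrite /m !rcdf_neg// subrr. Qed.

Lemma cdfB_right_continuous (y : R) : right_continuous_at m y.
Proof.
have := right_continuous_atD _ _ y (rcdf_right_continuous lap T y)
  (right_continuous_atZ (-1) _ y (rcdf_right_continuous lan T y)).
by congr right_continuous_at; apply/funext => s; rewrite mulN1r.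
Qed.

End cdf_difference.

(** Brings increments of [m] into the form compared by [nonincreasing_measure]. *)
Lemma itv_shift {R : realType} (h e : R) :
  [set h + a | a in `]0, e]] = `]h, h + e]%classic.
Proof.
apply/seteqP; split => [_ [a + <-]|s] /=; rewrite !in_itv/=.
  by rewrite ltrDl lerD2l.
by move=> /andP[hs se]; exists (s - h); rewrite ?subrKC// in_itv/=; apply/andP; split; lra.
Qed.

(** The hypothesis on the masses gives the sign of [f] at each [t k]; [nonneg_extension] carries it
    through the gap that follows. *)
Lemma nonincreasing_resolvent_preserves_nonnegativity (R : realType) (G : R -> R)
    (M : set R -> R) :
  (forall t, 0 <= t -> 0 <= G t) -> (forall t, 0 <= t -> right_continuous_at G t) ->
  0 < G 0 -> locally_integrable_on_nonneg G -> resolvent_first_kind G M ->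
  nonincreasing_measure M -> preserves_nonnegativity G.
Proof.
move=> G0 Grc G00 Gi rM niM K x t _ t0 t_mono xG s s0.
pose T := s + 1; have T0 : 0 < T by rewrite /T; lra.
have [lap [lan [MA gm m0]]] := resolvent_cdf G M T T0 G0 G00 Gi rM.
set m := fun y => rcdf lap T y - rcdf lan T y in gm m0.
have bm : bounded_measurable m := cdfB_bounded_measurable T lap lan.
have g1 := trunc_L1 G T (ltW T0) Gi.
(* The atom [m 0 = 1 / G 0] is positive, and right continuity keeps [m] positive for a while. *)
have m_near0 : exists2 d : R, 0 < d & forall u : R, 0 <= u -> u < d -> 0 <= m u.
  have m00 : 0 < m 0 by rewrite /m m0 invr_gt0.
  have [d d0 hd] := cdfB_right_continuous T lap lan 0 _ m00.
  exists d => // u u0 ud; have := hd u u0; rewrite add0r => /(_ ud).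
  by rewrite -/(m u) -/(m 0) ltr_norml => /andP[+ _]; lra.
have m_incr (y y' e : R) : 0 <= y -> y <= y' -> 0 <= e -> y' + e <= T ->
    m (y' + e) - m y' <= m (y + e) - m y.
  move=> y0 yy' e0 y'e.
  rewrite -!(cdfB_itv M T lap lan MA); try lra.
  rewrite -!itv_shift; apply: niM => //.
    by move=> z /=; rewrite !in_itv/= => /andP[/ltW ->].
  exists e; split; first by rewrite num_real.
  by move=> B eB z /=; rewrite in_itv/= => /andP[z0 ze]; rewrite gtr0_norm//; lra.
set f := massconv G T K x t.
have t_lt (i j : 'I_K) : (i <= j)%N -> t i <= t j.
  rewrite leq_eqVlt => /predU1P[ij|/t_mono/ltW//].
  by rewrite (_ : i = j)//; exact: val_inj.
(* Induction on a bound [n] for the indices of the masses at or before [s']. *)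
suff claim n (s' : R) : 0 <= s' -> s' < T -> (forall i, t i <= s' -> (i < n)%N) -> 0 <= f s'.
  rewrite -(massconvE G T K x t t0); last by rewrite /T; lra.
  by apply: (claim K) => //; rewrite /T; lra.
elim: n s' => [|n ih] s' s'0 s'T hs'.
  rewrite /f (massconvE G T K x t t0) ?(ltW s'T)// big_pred0 ?lexx// => i.
  by apply/negP => /hs'; rewrite ltn0.
have [nK|Kn] := ltnP n K; last first.
  by apply: ih => // i _; exact: leq_trans Kn.
pose k := Ordinal nK; have [ks|sk] := leP (t k) s'; last first.
  apply: ih => // i ti; have := hs' i ti; rewrite ltnS leq_eqVlt => /predU1P[ik|//].
  by move: sk; rewrite (_ : k = i) ?ltNge ?ti//; exact: val_inj.
(* The end of the gap: the next mass, or [T] if there is none before [T]. *)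
have [b [bT sb hb]] : exists b : R, [/\ b <= T, s' < b & forall i : 'I_K, (n < i)%N -> b <= t i].
  have [nK'|Kn'] := ltnP n.+1 K; last first.
    by exists T; split => // i ni; move: (leq_trans (ltn_ord i) Kn'); rewrite ltnS leqNgt ni.
  exists (Num.min T (t (Ordinal nK'))); split; first by rewrite ge_min lexx.
  - by rewrite lt_min s'T ltNge; apply/negP => /hs'; rewrite ltnn.
  - by move=> i ni; rewrite ge_min t_lt ?orbT.
have tE (v : R) : 0 <= v -> v <= b - t k ->
    conv f m (t k + v) = (\sum_(i < K | (i <= n)%N) x i * (t k - t i)) +
      (\sum_(i < K | (i <= n)%N) x i) * v.
  move=> v0 vb; rewrite (conv_massconv G m T K x t t0 (ltW T0) Gi)//; last by lra.
  rewrite mulr_suml -big_split/= [RHS]big_mkcond/=; apply: eq_bigr => i _.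
  case: ifPn => ni.
    by rewrite max_l -?mulrDr; [congr (_ * _); ring|have := t_lt i k ni; lra].
  by rewrite max_r ?mulr0//; have := hb i; rewrite ltnNge ni => /(_ isT); lra.
apply: (nonneg_extension f (trunc G T) m T (t k) b _ _
    (massconv_L1 _ _ _ _ _ _ _) _ g1 _ _ bm _ gm m_near0 m_incr _ _ bT _ _ _ tE) => //.
- exact: ltW.
- exact: massconv_neg.
- exact: trunc_neg.
- by move=> z; exact: trunc_ge0.
- by move=> y y0; exact: cdfB_neg.
- exact: le_lt_trans sb.
- move=> z z0 zk; apply: ih => //; first by lra.
  by move=> i ti; rewrite ltnNge; apply/negP => /(t_lt k i); lra.
- rewrite /f (massconvE G T K x t t0); last by lra.
  have := xG k; congr (0 <= _); apply: eq_bigl => i.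
  apply/idP/idP; first exact: t_lt.
  by rewrite leNgt leqNgt; apply: contra => /t_mono.
- by move=> z az zb; apply: massconv_right_continuous => //; exact: lt_le_trans bT.
Qed.

(** * Nonnegativity preserving nonincreasing kernels *)

Lemma course_of_values {A : Type} (F : seq A -> A) :
  exists r : nat -> A, forall n, r n = F (mkseq r n).
Proof.
pose tbl n := iter n (fun s => rcons s (F s)) [::].
exists (fun n => F (tbl n)) => n; congr F.
by elim: n => // n ih; rewrite mkseqS -ih.
Qed.

Lemma Rintegral_indic_itvco {R : realType} (x y : R) : x <= y ->
  \int[@lebesgue_measure R]_s (\1_`[x, y[ s) = y - x.
Proof.
move=> xy; rewrite /Rintegral integral_indic// setIT/= lebesgue_measure_itv/=.
rewrite lte_fin; case: ltP => // yx.
by rewrite (_ : y = x) ?subrr//; apply/eqP; rewrite eq_le xy yx.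
Qed.

Section discrete_resolvent.
Context {R : realType}.
Variable g : nat -> R.
Hypotheses (g0 : 0 < g 0%N) (g_ni : forall i, g i.+1 <= g i).

(** Grid analogue of the nonnegativity of the resolvent of a nonincreasing kernel; the [r k] will be
    the partial sums of the masses. *)
Lemma discrete_resolvent : exists r : nat -> R,
  [/\ r 0%N = (g 0%N)^-1, forall k, 0 <= r k &
      forall k, \sum_(j < k.+1) r j * g (k - j)%N = 1].
Proof.
(* Subtracting the equations for k and k + 1 gives a recursion whose
   coefficients are nonnegative since g is nonincreasing. *)
pose F (s : seq R) := (if size s is 0%N then 1 else
  \sum_(j < size s) nth 0 s j * (g (size s - j.+1)%N - g (size s - j)%N)) / g 0%N.
have [r rE] := course_of_values F.
have r0 : r 0%N = (g 0%N)^-1 by rewrite rE /F/= mul1r.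
have rS k : r k.+1 * g 0%N = \sum_(j < k.+1) r j * (g (k - j)%N - g (k.+1 - j)%N).
  rewrite rE /F size_mkseq divfK ?gt_eqF//; apply: eq_bigr => j _.
  by rewrite nth_mkseq// subSS.
exists r; split => // k.
  elim/ltn_ind: k => -[|k] ih; first by rewrite r0 invr_ge0 ltW.
  rewrite -(pmulr_lge0 _ g0) rS; apply: sumr_ge0 => j _.
  rewrite mulr_ge0 ?ih// subr_ge0 subSn; last by rewrite -ltnS.
  exact: g_ni.
elim: k => [|k ih]; first by rewrite big_ord1 r0 mulVf ?gt_eqF.
rewrite big_ord_recr/= subnn rS -big_split/= -[RHS]ih.
by apply: eq_bigr => j _; ring.
Qed.

End discrete_resolvent.

Section grid.
Context {R : realType}.
Notation mu := (@lebesgue_measure R).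
Variables (G : R -> R) (d : R).
Hypotheses (G_ni : forall s t : R, 0 <= s -> s <= t -> G t <= G s)
  (G0 : 0 < G 0) (d0 : 0 < d) (Gpres : preserves_nonnegativity G).

Let g (i : nat) : R := G (i%:R * d).

(** The masses are the first differences of the discrete resolvent, so their partial sums telescope
    to [r]. The sign of [x k.+1] comes from preservation: with the masses up to [k] alone, the sum
    at the next grid point is [- x k.+1 * g 0]. *)
Lemma grid_masses : exists x : nat -> R,
  [/\ [/\ x 0%N = (G 0)^-1, forall k, x k.+1 <= 0 & forall n, 0 <= \sum_(j < n.+1) x j],
      forall k, \sum_(j < k.+1) x j * g (k - j)%N = (k == 0%N)%:R &
      forall (K : nat) (s : R), 0 <= s ->
        0 <= \sum_(j < K | (j : nat)%:R * d <= s) x j * G (s - (j : nat)%:R * d)].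
Proof.
have gd (i j : nat) : (i <= j)%N -> g j <= g i.
  move=> ij; apply: G_ni; first by rewrite mulr_ge0// ltW.
  by rewrite ler_wpM2r ?ler_nat// ltW.
have g00 : 0 < g 0%N by rewrite /g mul0r.
have [r [r0 r_ge0 rg]] := discrete_resolvent g g00 (fun i => gd _ _ (leqnSn i)).
pose x k := if k is k'.+1 then r k - r k' else r 0%N.
have xg k : \sum_(j < k.+1) x j * g (k - j)%N = (k == 0%N)%:R.
  case: k => [|k]; first by rewrite big_ord1 /= r0 mulVf// gt_eqF.
  have := rg k.+1; have := rg k; rewrite big_ord_recl/= => h1.
  rewrite big_ord_recl/= => h2.
  rewrite big_ord_recl/= (eq_bigr (fun j : 'I_k.+1 => r j.+1 * g (k - j)%N - r j * g (k - j)%N)).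
    rewrite sumrB rg; move: h2; under eq_bigr do rewrite /bump leq0n add1n subSS.
    by rewrite subn0; lra.
  by move=> j _; rewrite /bump leq0n add1n /= subSS mulrBl.
have tsB (i j : nat) : (j <= i)%N -> i%:R * d - j%:R * d = (i - j)%N%:R * d.
  by move=> ji; rewrite natrB// mulrBl.
have pos (K : nat) (s : R) : 0 <= s ->
    0 <= \sum_(j < K | (j : nat)%:R * d <= s) x j * G (s - (j : nat)%:R * d).
  case: K => [|k] s0; first by rewrite big_ord0.
  pose xs (j : 'I_k.+1) := x j; pose ts (j : 'I_k.+1) := (j : nat)%:R * d.
  apply: (Gpres k.+1 xs ts) => //.
  - by move=> j; rewrite mulr_ge0// ltW.
  - by move=> i j ij; rewrite ltr_pM2r// ltr_nat.
  - move=> i.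
    rewrite (eq_bigl (fun j : 'I_k.+1 => (j < i.+1)%N))//.
    rewrite (eq_bigr (fun j : 'I_k.+1 => x j * G (i%:R * d - (j : nat)%:R * d)))//.
    rewrite -(big_ord_widen k.+1 (fun j => x j * G (i%:R * d - j%:R * d)))//.
    rewrite (eq_bigr (fun j : 'I_i.+1 => x j * g (i - j)%N)) ?xg// => j _.
    by rewrite /g tsB// -ltnS.
exists x; split => //; split; first by rewrite /= r0 /g mul0r.
- move=> k.
  have kd0 : 0 <= k.+1%:R * d by rewrite mulr_ge0// ltW.
  have := pos k.+1 (k.+1%:R * d) kd0.
  have -> : \sum_(j < k.+1 | (j : nat)%:R * d <= k.+1%:R * d)
      x j * G (k.+1%:R * d - (j : nat)%:R * d) = - (x k.+1 * g 0%N).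
    apply/eqP; rewrite -addr_eq0; apply/eqP; rewrite -[RHS](xg k.+1) big_ord_recr/= subnn.
    congr (_ + _); rewrite (eq_bigl xpredT); last first.
      by move=> j; rewrite ler_pM2r// ler_nat ltnW.
    by apply: eq_bigr => j _; rewrite tsB// ltnW.
  by rewrite oppr_ge0 pmulr_lle0.
- move=> n; rewrite (_ : \sum_(j < n.+1) x j = r n)//.
  elim: n => [|n ih]; first by rewrite big_ord1.
  by rewrite big_ord_recr/= ih; ring.
Qed.

End grid.

(** Discrete counterpart of integrating one factor of a convolution. *)
Lemma discrete_conv_exchange {R : realType} (x h : nat -> R) n :
  \sum_(k < n.+1) \sum_(j < k.+1) x j * h (k - j)%N =
  \sum_(j < n.+1) x j * \sum_(i < (n - j).+1) h i.
Proof.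
elim: n => [|n ih]; first by rewrite !big_ord1.
rewrite big_ord_recr/= ih [RHS]big_ord_recr/= subnn big_ord1.
rewrite [X in _ + X = _]big_ord_recr/= subnn addrA -big_split/=; congr (_ + _).
apply: eq_bigr => j _; rewrite -mulrDr; congr (_ * _).
by rewrite subSn -1?ltnS// [RHS]big_ord_recr.
Qed.

Lemma L1_Rintegral_sum {R : realType} (I : Type) (r : seq I) (F : I -> R -> R) :
  (forall i, L1 (F i)) ->
  \int[@lebesgue_measure R]_s (\sum_(i <- r) F i s) =
  \sum_(i <- r) \int[@lebesgue_measure R]_s (F i s).
Proof.
move=> F1; elim: r => [|i r ih].
  by rewrite big_nil; apply: (Rintegral_supp1 0) => s _; rewrite big_nil.
rewrite big_cons -ih -RintegralD//; [|exact: F1|exact: L1_sum].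
by apply: eq_Rintegral => s _; rewrite big_cons.
Qed.

Section grid_approximation.
Context {R : realType}.
Notation mu := (@lebesgue_measure R).
Variables (G m : R -> R) (T d B : R).
Hypotheses (G_ni : forall s t : R, 0 <= s -> s <= t -> G t <= G s)
  (G0 : 0 < G 0) (Gpres : preserves_nonnegativity G)
  (Gi : locally_integrable_on_nonneg G).
Hypotheses (d0 : 0 < d) (d1 : d <= 1) (T0 : 0 < T).
Hypotheses (bm : bounded_measurable m) (mB : forall y, `|m y| <= B)
  (m_neg : forall y : R, y < 0 -> m y = 0)
  (gm : forall t : R, t <= T + 1 -> conv (trunc G (T + 1)) m t = Num.max t 0).

(** Bounds both the deviation of [f] from 1 on [[0, d[] and, per unit of [d], the mass of [f] beyond
    [d]; hence the factor 2 in the estimate below. *)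
Let tail : R := 1 - G d / G 0.

(** Here [y t] is [f * m] at [t + d], divided by [d], computed in two ways: through [G * m = t_+] it
    is a sum of ramps, whose shape follows from the signs of [x]; as an integral it is nearly an
    average of [m] over []t, t + d]], which gives the error. *)
Lemma grid_approximation : exists y : R -> R,
  [/\ forall a b c : R, 0 <= a -> a < b -> b < c ->
        (c - b) * y a + (b - a) * y c <= (c - a) * y b,
      forall a b : R, 0 <= a -> a <= b -> y a <= y b &
      forall t eta : R, 0 <= t -> t + d <= T ->
        (forall u : R, t <= u -> u <= t + d -> `|m u - m t| <= eta) ->
        `|y t - m t| <= eta + 2 * tail * B].
Proof.
have [x [[x0 x_le0 sx_ge0] xg pos]] := grid_masses G d G_ni G0 d0 Gpres.
(* The grid cells end at [(n + 1) d], beyond [T] by at most [d <= 1]; the window [T + 1] allows for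
   this. *)
pose n := Num.truncn (T / d).
have [nT Tn] : n%:R * d <= T /\ T < n.+1%:R * d.
  have := truncn_itv (ltW (divr_gt0 T0 d0)); rewrite -/n.
  by rewrite ler_pdivlMr// ltr_pdivrMr// => /andP.
have T1 : n.+1%:R * d <= T + 1 by rewrite -natr1 mulrDl mul1r; have := d1; lra.
have T10 : 0 <= T + 1 by have := T0; lra.
pose xs (j : 'I_n.+1) := x j; pose ts (j : 'I_n.+1) := (j : nat)%:R * d.
have ts0 j : 0 <= ts j by rewrite mulr_ge0// ltW.
set f := massconv G (T + 1) n.+1 xs ts.
have f_neg (s : R) : s < 0 -> f s = 0 by exact: massconv_neg.
have f_ge0 (s : R) : s <= T + 1 -> 0 <= f s.
  move=> sT; have [s0|s0] := ltP s 0; first by rewrite f_neg.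
  by rewrite /f (massconvE G (T + 1) n.+1 xs ts ts0)//; exact: pos.
have f1 : L1 f by exact: massconv_L1.
have f_bin (k : nat) (u : R) : (k <= n)%N -> 0 <= u -> u < d ->
    f (k%:R * d + u) = \sum_(j < k.+1) x j * G ((k - j)%N%:R * d + u).
  move=> kn u0 ud; rewrite /f (massconvE G (T + 1) n.+1 xs ts ts0); last first.
    apply: le_trans T1; rewrite -natr1 mulrDl mul1r lerD ?(ltW ud)//.
    by rewrite ler_wpM2r ?ler_nat// ltW.
  rewrite (big_ord_widen n.+1 (fun j => x j * G ((k - j)%N%:R * d + u)))//.
  apply: eq_big => j.
    rewrite /ts ltnS; apply/idP/idP => h.
      rewrite -ltnS -(ltr_nat R) -(ltr_pM2r d0) (le_lt_trans h)// -natr1 mulrDl mul1r.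
      by rewrite ltrD2l.
    by rewrite -[leLHS]addr0 lerD// ler_wpM2r ?ler_nat// ltW.
  move=> h; congr (_ * G _); rewrite /ts natrB; first by ring.
  rewrite -ltnS -(ltr_nat R) -(ltr_pM2r d0) (le_lt_trans h)// -natr1 mulrDl mul1r.
  by rewrite ltrD2l.
have tail_ge0 : 0 <= tail.
  by rewrite subr_ge0 ler_pdivrMr// mul1r; apply: G_ni => //; exact: ltW.
(* Subtracting the grid equations replaces [G] by its decrements [h]. After the exchange of sums,
   the total is [x 0 * h 0] minus the quantity [Epos], and [x 0 * h 0 <= tail]. *)
have f_tail (u : R) : 0 <= u -> u < d -> \sum_(k < n) f (k.+1%:R * d + u) <= tail.
  move=> u0 ud; pose h i := G (i%:R * d) - G (i%:R * d + u).
  have h_ge0 i : 0 <= h i.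
    by rewrite subr_ge0; apply: G_ni; rewrite ?lerDl// mulr_ge0// ltW.
  have fh (k : nat) : (k < n)%N ->
      f (k.+1%:R * d + u) = - \sum_(j < k.+2) x j * h (k.+1 - j)%N.
    move=> kn; rewrite f_bin//; apply/eqP; rewrite -addr_eq0 -big_split/=; apply/eqP.
    rewrite -[RHS](xg k.+1); apply: eq_bigr => j _; rewrite /h; ring.
  rewrite (eq_bigr (fun k : 'I_n => - \sum_(j < k.+2) x j * h (k.+1 - j)%N)); last first.
    by move=> k _; rewrite fh.
  have := discrete_conv_exchange x h n; rewrite big_ord_recl/= big_ord1/=.
  under [X in _ + X = _]eq_bigr do rewrite /bump leq0n add1n.
  rewrite sumrN => E.
  have Epos : 0 <= \sum_(j < n.+1) x j * \sum_(i < (n - j).+1) h i.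
    (* Completing the partial sums of [h] only lowers the terms with [x j <= 0], and the term
       [j = 0] already has the full sum; what results is a nonnegative sum of masses times a
       nonnegative number. *)
    apply: (@le_trans _ _ (\sum_(j < n.+1) x j * \sum_(i < n.+1) h i)).
      by rewrite -mulr_suml mulr_ge0// sumr_ge0.
    rewrite big_ord_recl [leRHS]big_ord_recl/= subn0 lerD2l; apply: ler_sum => j _.
    rewrite /bump leq0n add1n ler_wnM2l//.
    rewrite (big_ord_widen n.+1 (fun i => h i)); last by rewrite ltnS leq_subr.
    by rewrite [leRHS](bigID (fun i : 'I_n.+1 => (i < (n - j.+1).+1)%N))/= lerDl sumr_ge0.
  have x0h : x 0%N * h 0%N <= tail.
    rewrite x0 /h mul0r add0r /tail mulrBr mulVf ?gt_eqF// lerB// [leRHS]mulrC ler_pM2r ?invr_gt0//.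
    by apply: G_ni => //; exact: ltW.
  by lra.
exists (fun t => d^-1 * \sum_(j < n.+1) x j * Num.max (t + d - (j : nat)%:R * d) 0).
have dV : 0 < d^-1 by rewrite invr_gt0.
split.
- move=> a b c a_ge0 ab bc.
  rewrite [(c - b) * _]mulrCA [(b - a) * _]mulrCA [(c - a) * _]mulrCA -mulrDr ler_pM2l//.
  (* The ramp of mass 0 is affine at nonnegative times; the others are convex with coefficients
     [<= 0]. *)
  rewrite !mulr_sumr -big_split/=; apply: ler_sum => -[[|j] jn] _ /=.
    by rewrite mul0r !subr0 !max_l; [|have := d0; lra..]; lra.
  rewrite [(c - b) * _]mulrCA [(b - a) * _]mulrCA [(c - a) * _]mulrCA -mulrDr ler_wnM2l//.
  set w := j.+1%:R * d.
  have cb0 : 0 <= c - b by lra.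
  have ba0 : 0 <= b - a by lra.
  have [h|h] := leP (b + d - w) 0.
    by rewrite mulr0 addr_ge0// mulr_ge0// le_max lexx orbT.
  have h1 : a + d - w <= Num.max (a + d - w) 0 by rewrite le_max lexx.
  have h2 : c + d - w <= Num.max (c + d - w) 0 by rewrite le_max lexx.
  have := lerD (ler_wpM2l cb0 h1) (ler_wpM2l ba0 h2); apply: le_trans.
  by rewrite le_eqVlt; apply/orP; left; apply/eqP; ring.
- move=> a b a_ge0 ab; rewrite ler_pM2l// -subr_ge0 -sumrB.
  (* Each ramp grows by at most [b - a], with equality for mass 0, the only positive one. *)
  apply: (@le_trans _ _ (\sum_(j < n.+1) x j * (b - a))).
    by rewrite -mulr_suml mulr_ge0// subr_ge0.
  apply: ler_sum => -[[|j] jn] _ /=; rewrite -mulrBr.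
    rewrite mul0r !subr0 !max_l; [|have := d0; lra..].
    by rewrite (_ : b + d - (a + d) = b - a)//; ring.
  rewrite ler_wnM2l//.
  by have [] := leP (a + d - j.+1%:R * d) 0; have [] := leP (b + d - j.+1%:R * d) 0; lra.
move=> t eta t0 tT meta.
have eta0 : 0 <= eta.
  by apply: le_trans (meta t (lexx _) _); rewrite ?subrr ?normr0// lerDl ltW.
have B0 : 0 <= B := le_trans (normr_ge0 _) (mB 0).
have tT1 : t + d <= T + 1 by have := tT; lra.
rewrite -(conv_massconv G m (T + 1) n.+1 xs ts ts0 T10 Gi (t + d) bm gm tT1) -/f.
rewrite (_ : _ - _ = d^-1 * (conv f m (t + d) - m t * d)); last first.
  by rewrite mulrBr mulrCA mulVf ?mulr1// gt_eqF.
rewrite normrM gtr0_norm// ler_pdivrMl//.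
have ind1 (s e : R) : s <= e -> L1 (\1_`[s, e[) by move=> _; exact: integrable_indic_itv.
have mt_int : m t * d = \int[mu]_s (m t * \1_`[0, d[ s).
  by rewrite RintegralZl ?Rintegral_indic_itvco ?subr0 ?ltW//; exact: ind1 (ltW d0).
have fm1 : L1 (fun s => f s * m (t + d - s)) by exact: conv_L1.
have mt1 : L1 (fun s => m t * \1_`[0, d[ s) by apply/L1Z/ind1/ltW.
have dif1 : L1 (fun s => f s * m (t + d - s) - m t * \1_`[0, d[ s).
  rewrite (_ : (fun s => _) = fun s => f s * m (t + d - s) + -1 * (m t * \1_`[0, d[ s)).
    by apply: L1D => //; exact: L1Z.
  by apply/funext => s; rewrite mulN1r.
rewrite mt_int /conv -RintegralB//.
apply: le_trans (le_normr_Rintegral _ _) _ => //.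
(* The piece of [f] on the cell starting at [(k + 1) d]; cell 0 is left out because there [f] is
   compared with 1. *)
pose bin (k : 'I_n) s := f s * \1_`[0, d[ (s - k.+1%:R * d).
have bin1 k : L1 (bin k).
  apply: L1M => //; have [mi [Bi hi]] := @bounded_measurable_itv R `[0, d[.
  split; last by exists Bi.
  exact: measurableT_comp mi (measurable_shift _).
have bsum1 : L1 (fun s => \sum_(k < n) bin k s) by exact: L1_sum.
(* Pointwise majorant of the error: on [[0, d[] the oscillation of [m] plus the deviation of [f]
   from 1 times [B]; beyond, [f] itself times [B]. *)
have bound1 : L1 (fun s => (eta + tail * B) * \1_`[0, d[ s + B * \sum_(k < n) bin k s).
  by apply: L1D; apply: L1Z => //; exact: ind1 (ltW d0).
apply: (@le_trans _ _ (\int[mu]_s ((eta + tail * B) * \1_`[0, d[ s + B * \sum_(k < n) bin k s))).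
  apply: le_L1_Rintegral => //; first exact: integrable_norm dif1.
  move=> s.
  have rhs0 : 0 <= (eta + tail * B) * \1_`[0, d[ s by rewrite mulr_ge0 ?addr_ge0 ?mulr_ge0// indicE.
  have bin_ge0 k : 0 <= bin k s.
    rewrite /bin indicE; case: (boolP (_ \in _)); rewrite ?mulr0// mulr1 inE/= in_itv/= => /andP[_ sk].
    apply: f_ge0; apply: le_trans T1; rewrite -natr1 mulrDl mul1r.
    have : k.+1%:R * d <= n%:R * d by rewrite ler_wpM2r ?ler_nat// ltW.
    by lra.
  have bsum_ge0 : 0 <= B * \sum_(k < n) bin k s by rewrite mulr_ge0// sumr_ge0.
  have [s0|s0] := ltP s 0.
    rewrite f_neg// indicE memNset; last by rewrite /= in_itv/= => /andP[]; lra.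
    by rewrite mul0r mulr0 subrr normr0 mulr0 add0r.
  have [sd|ds] := ltP s d.
    have -> : \1_`[0, d[ s = 1 :> R by rewrite indicE mem_set//= in_itv/= s0.
    rewrite !mulr1 -[leLHS]addr0 lerD//.
    have fs : f s = G s / G 0.
      rewrite -[in LHS](add0r s) -(mul0r d) -[X in X * d](mulr0n 1) (f_bin 0%N)// big_ord1 mulrC.
      by rewrite x0 mul0r add0r.
    have fs1 : `|f s - 1| <= tail.
      rewrite fs ler0_norm ?opprB; last first.
        by rewrite subr_le0 ler_pdivrMr// mul1r; apply: G_ni.
      rewrite lerB// ler_pM2r ?invr_gt0//; apply: G_ni => //; exact: ltW.
    rewrite (_ : f s * m (t + d - s) - m t =
      (m (t + d - s) - m t) + (f s - 1) * m (t + d - s)); last by ring.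
    rewrite (le_trans (ler_normD _ _))// lerD ?meta//; try lra.
    by rewrite normrM ler_pM.
  have -> : \1_`[0, d[ s = 0 :> R.
    by rewrite indicE memNset//= in_itv/= => /andP[_]; rewrite ltNge ds.
  rewrite !mulr0 subr0 add0r.
  have [st|ts_] := ltP (t + d) s; first by rewrite m_neg ?mulr0 ?normr0//; lra.
  have sd0 : 0 <= s / d by rewrite divr_ge0// ltW.
  have := truncn_itv sd0; set k := Num.truncn _.
  rewrite ler_pdivlMr// ltr_pdivrMr// => /andP[ks sk].
  have k0 : (0 < k)%N.
    rewrite lt0n; apply/eqP => k0; move: sk; rewrite k0 mul1r; lra.
  have kn : (k.-1 < n)%N.
    rewrite prednK// -ltnS -(ltr_nat R) -(ltr_pM2r d0); apply: le_lt_trans ks _.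
    by apply: le_lt_trans Tn; have := tT; lra.
  have sT1 : s <= T + 1 by lra.
  rewrite normrM (ger0_norm (f_ge0 s sT1)) mulrC ler_pM//; first exact: f_ge0.
  rewrite (bigD1 (Ordinal kn))//= -[leLHS]addr0 lerD//; last exact: sumr_ge0.
  rewrite /bin/= prednK// indicE mem_set ?mulr1//= in_itv/= subr_ge0 ks/=.
  by move: sk; rewrite -natr1 mulrDl mul1r; lra.
rewrite RintegralD//; last 2 first.
- by apply: L1Z; exact: ind1 (ltW d0).
- exact: L1Z.
rewrite RintegralZl//; last exact: ind1 (ltW d0).
rewrite Rintegral_indic_itvco ?(ltW d0)// subr0 RintegralZl//.
(* Translating all cells back onto [[0, d[] puts them under one integral, where [f_tail] applies at
   each offset. *)
have -> : \int[mu]_s (\sum_(k < n) bin k s) =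
    \int[mu]_s ((\sum_(k < n) f (k.+1%:R * d + s)) * \1_`[0, d[ s).
  transitivity (\sum_(k < n) \int[mu]_s bin k s).
    exact: L1_Rintegral_sum.
  transitivity (\sum_(k < n) \int[mu]_s (f (k.+1%:R * d + s) * \1_`[0, d[ s)).
    apply: eq_bigr => k _; rewrite -(Rintegral_shift (k.+1%:R * d))//.
    by apply: eq_Rintegral => s _; rewrite /bin addrK addrC.
  have fk1 (k : 'I_n) : L1 (fun s => f (k.+1%:R * d + s) * \1_`[0, d[ s).
    apply: L1M; last exact: bounded_measurable_itv.
    rewrite (_ : (fun s => _) = fun s => f (s + k.+1%:R * d)); first exact: L1_shift.
    by apply/funext => s; rewrite addrC.
  rewrite -L1_Rintegral_sum//.
  by apply: eq_Rintegral => s _; rewrite mulr_suml.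
have tl : \int[mu]_s ((\sum_(k < n) f (k.+1%:R * d + s)) * \1_`[0, d[ s) <= tail * d.
  rewrite (_ : tail * d = \int[mu]_s (tail * \1_`[0, d[ s)); last first.
    rewrite RintegralZl//; last exact: ind1 (ltW d0).
    by rewrite Rintegral_indic_itvco ?subr0 ?ltW.
  apply: le_L1_Rintegral.
  - apply: L1M; last exact: bounded_measurable_itv.
    apply: L1_sum => k; rewrite (_ : (fun s => _) = fun s => f (s + k.+1%:R * d)); first exact: L1_shift.
    by apply/funext => s; rewrite addrC.
  - by apply: L1Z; exact: ind1 (ltW d0).
  move=> s; rewrite indicE; case: (boolP (_ \in _)); rewrite ?mulr0// !mulr1 inE/= in_itv/=.
  by move=> /andP[s0 sd]; exact: f_tail.
have := ler_wpM2l B0 tl; lra.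
Qed.

End grid_approximation.

Section cdf_concave.
Context {R : realType}.
Variables (G m : R -> R) (T : R).
Hypotheses (G_ni : forall s t : R, 0 <= s -> s <= t -> G t <= G s)
  (G0 : 0 < G 0) (Gpres : preserves_nonnegativity G)
  (Gi : locally_integrable_on_nonneg G) (Grc : right_continuous_at G 0).
Hypotheses (T0 : 0 < T).
Hypotheses (bm : bounded_measurable m) (m_rc : forall y, right_continuous_at m y)
  (m_neg : forall y : R, y < 0 -> m y = 0)
  (gm : forall t : R, t <= T + 1 -> conv (trunc G (T + 1)) m t = Num.max t 0).

(** The concavity inequality mixes three values, so one grid has to approximate [m] at all three
    points. *)
Lemma concave_approximation (a b c e : R) :
  0 <= a -> a <= b -> b <= c -> c < T -> 0 < e -> exists y : R -> R,
  [/\ forall a b c : R, 0 <= a -> a < b -> b < c ->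
        (c - b) * y a + (b - a) * y c <= (c - a) * y b,
      forall a b : R, 0 <= a -> a <= b -> y a <= y b &
      [/\ `|y a - m a| <= e, `|y b - m b| <= e & `|y c - m c| <= e]].
Proof.
move=> a0 ab bc cT e0.
have [B B0 mB] := bounded_measurable_ge0 _ bm.
have e2 : 0 < e / 2 by rewrite divr_gt0.
have B1 : 0 < 4 * (B + 1) by lra.
(* This closeness of [G d] to [G 0] gives [2 * tail * B <= e / 2]; the other half of [e] is for the
   oscillation of [m]. *)
have eG : 0 < e / (4 * (B + 1)) * G 0 by rewrite mulr_gt0// divr_gt0.
have [da da0 ha] := m_rc a _ e2.
have [db db0 hb] := m_rc b _ e2.
have [dc dc0 hc] := m_rc c _ e2.
have [dG dG0 hG] := Grc _ eG.
pose D := Num.min (Num.min da db) (Num.min dc (Num.min dG (Num.min 1 (T - c)))).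
have D0 : 0 < D by rewrite /D !lt_min da0 db0 dc0 dG0 ltr01 subr_gt0 cT.
have : D <= D by []; rewrite {2}/D !le_min => /andP[/andP[Da Db] /andP[Dc /andP[DG /andP[D1 DT]]]].
have [d [d0 dD]] : exists d : R, 0 < d /\ d < D by exists (D / 2); lra.
have d1 : d <= 1 by lra.
have [y [y1 y2 y3]] := grid_approximation G m T d B G_ni G0 Gpres Gi d0 d1 T0 bm mB m_neg gm.
exists y; split => //.
set tail := (1 - G d / G 0) in y3.
have tail_le : 2 * tail * B <= e / 2.
  have : `|G d - G 0| < e / (4 * (B + 1)) * G 0 by apply: hG; lra.
  rewrite -ltr_pdivrMr// => h.
  have {}h : tail <= e / (4 * (B + 1)).
    apply: le_trans (ltW h); rewrite ler_pdivlMr// /tail mulrBl mul1r divfK ?gt_eqF//.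
    by rewrite distrC ler_norm.
  have : tail * B <= e / (4 * (B + 1)) * B by rewrite ler_wpM2r.
  have : e / (4 * (B + 1)) * B <= e / 4.
    rewrite mulrAC ler_pdivrMr// (_ : e / 4 * (4 * (B + 1)) = e * (B + 1)); last by field.
    by rewrite ler_pM2l//; lra.
  by lra.
have fin (p : R) : 0 <= p -> p <= c -> (forall u : R, p <= u -> u < p + D -> `|m u - m p| < e / 2) ->
    `|y p - m p| <= e.
  move=> p0 pc h; apply: le_trans (y3 p (e / 2) p0 _ _) _; [lra| |lra].
  by move=> u pu ud; apply/ltW/h => //; lra.
split; apply: fin; try lra.
- by move=> u au uD; apply: ha => //; lra.
- by move=> u au uD; apply: hb => //; lra.
- by move=> u au uD; apply: hc => //; lra.
Qed.

Lemma cdf_nondecreasing (a b : R) : 0 <= a -> a <= b -> b < T -> m a <= m b.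
Proof.
move=> a0 ab bT; apply/ler_addgt0Pr => e e0.
have e2 : 0 < e / 2 by rewrite divr_gt0.
have [y [_ y2 [ya yb _]]] := concave_approximation a b b (e / 2) a0 ab (lexx _) bT e2.
have := y2 a b a0 ab.
by move: ya yb; rewrite !ler_norml => /andP[? ?] /andP[? ?]; lra.
Qed.

Lemma cdf_concave (a b c : R) : 0 <= a -> a < b -> b < c -> c < T ->
  (c - b) * m a + (b - a) * m c <= (c - a) * m b.
Proof.
move=> a0 ab bc cT; apply/ler_addgt0Pr => e e0.
have ca : 0 < c - a by lra.
(* The three errors carry the weights [c - b], [b - a] and [c - a], in total [2 * (c - a)]. *)
pose e' := e / (2 * (c - a)).
have e'0 : 0 < e' by rewrite divr_gt0// mulr_gt0.
have [y [y1 _ [ya yb yc]]] := concave_approximation a b c e' a0 (ltW ab) (ltW bc) cT e'0.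
have := y1 a b c a0 ab bc.
move: ya yb yc; rewrite !ler_norml => /andP[h1 h2] /andP[h3 h4] /andP[h5 h6].
have cb : 0 <= c - b by lra.
have ba : 0 <= b - a by lra.
have k1 : (c - b) * m a <= (c - b) * (y a + e') by rewrite ler_wpM2l//; lra.
have k2 : (b - a) * m c <= (b - a) * (y c + e') by rewrite ler_wpM2l//; lra.
have k3 : (c - a) * y b <= (c - a) * (m b + e') by rewrite ler_wpM2l//; lra.
have E : e = 2 * (c - a) * e' by rewrite /e' mulrC divfK// gt_eqF// mulr_gt0.
by rewrite E; lra.
Qed.

End cdf_concave.

(** * The right derivative of a concave function as its density *)

Section concave_density.
Context {R : realType}.
Notation mu := (@lebesgue_measure R).
Variable m : R -> R.
Hypothesis m_concave : forall a b c : R, 0 <= a -> a < b -> b < c ->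
  (c - b) * m a + (b - a) * m c <= (c - a) * m b.
Hypothesis m_nd : forall a b : R, 0 <= a -> a <= b -> m a <= m b.
Hypothesis m_rc0 : right_continuous_at m 0.

Let slopes (t : R) := [set (m (t + h) - m t) / h | h in `]0, +oo[].

(** For concave [m] the slopes decrease in [h], so their supremum is the right derivative. The
    default 0 avoids the slope at 0, which may be infinite. *)
Definition right_slope (t : R) : R := if 0 < t then sup (slopes t) else 0.

Notation r := right_slope.

Let slope_le (a b h : R) : 0 <= a -> a < b -> 0 < h ->
  (m (b + h) - m b) / h <= (m b - m a) / (b - a).
Proof.
move=> a0 ab h0; have ba : 0 < b - a by rewrite subr_gt0.
have bh : b < b + h by rewrite ltrDl.
rewrite ler_pdivrMr// mulrAC ler_pdivlMr//.
by have := m_concave a b (b + h) a0 ab bh; lra.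
Qed.

Let slopes_ub (a b : R) : 0 <= a -> a < b -> ubound (slopes b) ((m b - m a) / (b - a)).
Proof.
by move=> a0 ab _ [h /= + <-]; rewrite in_itv/= andbT => h0; exact: slope_le.
Qed.

Let slopes_nonempty (t : R) : slopes t !=set0.
Proof. by exists ((m (t + 1) - m t) / 1), 1 => //=; rewrite in_itv/= ltr01. Qed.

Lemma right_slope_le (a b : R) : 0 <= a -> a < b -> (b - a) * r b <= m b - m a.
Proof.
move=> a0 ab; have b0 : 0 < b by exact: le_lt_trans ab.
rewrite mulrC -ler_pdivlMr ?subr_gt0// /right_slope b0.
by apply: ge_sup => //; exact: slopes_ub.
Qed.

Lemma right_slope_ge (a b : R) : 0 < a -> a < b -> m b - m a <= (b - a) * r a.
Proof.
move=> a0 ab; rewrite mulrC -ler_pdivrMr ?subr_gt0// /right_slope a0.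
apply: ub_le_sup.
  by exists ((m a - m 0) / (a - 0)); exact: slopes_ub.
by exists (b - a); rewrite /= ?in_itv/= ?subr_gt0 ?ab// subrKC.
Qed.

Lemma right_slope_ge0 t : 0 <= r t.
Proof.
have [t0|t0] := ltP 0 t; last by rewrite /right_slope ltNge t0.
have tt : t < t + 1 by rewrite ltrDl.
have := right_slope_ge t (t + 1) t0 tt; rewrite [t + 1 - t]addrC addKr mul1r.
by apply: le_trans; rewrite subr_ge0 m_nd// ltW.
Qed.

Lemma right_slope_ni (s t : R) : 0 < s -> s <= t -> r t <= r s.
Proof.
rewrite le_eqVlt => s0 /predU1P[->//|st].
have := right_slope_le s t (ltW s0) st; have := right_slope_ge s t s0 st.
by move=> h1 h2; have := le_trans h2 h1; rewrite ler_pM2l// subr_gt0.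
Qed.

(** Superlevel sets of a monotone function on []0, +oo[] are intervals; the default 0 extends
    measurability to the line. *)
Lemma measurable_right_slope : measurable_fun setT r.
Proof.
have mD : measurable (`]0, +oo[%classic : set R) by exact: measurable_itv.
have h : measurable_fun (`]0, +oo[%classic : set R) r.
  apply: (measurability (@RGenCInfty.G R)) => [|/= _ [_] [c] -> <-].
    exact: RGenCInfty.measurableE.
  apply: is_interval_measurable => s t/=.
  rewrite !in_itv/= !andbT => -[s0 rs] [t0 rt] u /andP[su ut].
  have u0 : 0 < u by exact: lt_le_trans su.
  by rewrite !in_itv/= !andbT u0 (le_trans rt)// right_slope_ni.
have := (measurable_restrictT r mD).1 h; congr measurable_fun.
apply/funext => x; rewrite patchE; case: ifPn => //.
by rewrite notin_setE/= in_itv/= andbT /right_slope => /negP/negbTE ->.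
Qed.

Lemma integrable_right_slope (a b : R) : 0 < a -> mu.-integrable `]a, b] (EFin \o r).
Proof.
move=> a0; apply: measurable_bounded_integrable.
- exact: measurable_itv.
- by rewrite /= lebesgue_measure_itv/=; case: ifP => _; rewrite ltry.
- exact: measurable_funS measurable_right_slope.
- exists (r a); split; first by rewrite num_real.
  move=> B aB x /=; rewrite in_itv/= => /andP[ax _].
  by rewrite ger0_norm ?right_slope_ge0// (le_trans _ (ltW aB))// right_slope_ni// ltW.
Qed.

Let J (a b : R) : R := \int[mu]_(x in `]a, b]) r x.

Let J_bounds (a b : R) : 0 < a -> a < b -> (b - a) * r b <= J a b /\ J a b <= (b - a) * r a.
Proof.
move=> a0 ab.
have I k : \int[mu]_(x in `]a, b]) k = (b - a) * k.
  rewrite Rintegral_cst; last exact: measurable_itv.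
  by rewrite /= lebesgue_measure_itv/= lte_fin ab mulrC.
have ci k : mu.-integrable `]a, b] (EFin \o cst k).
  apply: measurable_bounded_integrable.
  - exact: measurable_itv.
  - by rewrite /= lebesgue_measure_itv/=; case: ifP => _; rewrite ltry.
  - exact: measurable_cst.
  - by exists `|k|; split => // B kB x _; exact: ltW.
have ri := integrable_right_slope a b a0.
rewrite -!I; split; apply: le_Rintegral => //; try exact: measurable_itv; try exact: ci.
- by move=> x /=; rewrite in_itv/= => /andP[ax xb]; rewrite right_slope_ni// (lt_trans a0).
- by move=> x /=; rewrite in_itv/= => /andP[ax xb]; rewrite right_slope_ni// ltW.
Qed.

Let J_add (a b c : R) : 0 < a -> a <= b -> b <= c -> J a c = J a b + J b c.
Proof.
move=> a0 ab bc; apply/eqP; rewrite addrC -subr_eq; apply/eqP; rewrite /J.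
apply: Rintegral_itvB => //; rewrite ?bnd_simp//.
exact: integrable_right_slope.
Qed.

(** On each of the [n] steps both the integral and the increment of [m] lie between [h] times the
    right and left end values of the slope; these errors telescope. *)
Let J_approx (n : nat) (a h : R) : 0 < a -> 0 < h ->
  `|J a (a + n%:R * h) - (m (a + n%:R * h) - m a)| <= h * (r a - r (a + n%:R * h)).
Proof.
move=> a0 h0; elim: n => [|n ih].
  rewrite mul0r addr0 !subrr mulr0 subr0 /J set_itv_ge ?bnd_simp ?ltxx//.
  by rewrite Rintegral_set0 normr0.
set b := a + n%:R * h in ih *; have -> : a + n.+1%:R * h = b + h.
  by rewrite /b -natr1; ring.
have nh : 0 <= n%:R * h by rewrite mulr_ge0// ltW.
have ab : a <= b by rewrite /b lerDl.
have b0 : 0 < b by exact: lt_le_trans ab.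
have bh : b < b + h by rewrite ltrDl.
rewrite (J_add a b (b + h))// ?(ltW bh)//.
have [j1 j2] := J_bounds b (b + h) b0 bh.
have s1 := right_slope_le b (b + h) (ltW b0) bh.
have s2 := right_slope_ge b (b + h) b0 bh.
move: j1 j2 s1 s2; rewrite [b + h - b]addrC addKr => j1 j2 s1 s2.
have k : `|J b (b + h) - (m (b + h) - m b)| <= h * (r b - r (b + h)).
  by rewrite ler_norml; apply/andP; split; lra.
rewrite (_ : _ - _ = (J a b - (m b - m a)) + (J b (b + h) - (m (b + h) - m b))); last by ring.
by rewrite (le_trans (ler_normD _ _))// (le_trans (lerD ih k))//; lra.
Qed.

Let J_eq (a b : R) : 0 < a -> a < b -> J a b = m b - m a.
Proof.
move=> a0 ab; apply/eqP; rewrite -subr_eq0 -normr_le0; apply/ler_addgt0Pr => e e0.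
rewrite add0r; pose C := (b - a) * (r a - r b).
have C0 : 0 <= C by rewrite mulr_ge0// subr_ge0 ?(ltW ab)// right_slope_ni// ltW.
pose n := (Num.bound (C / e)).+1; have n0 : 0 < n%:R :> R by rewrite ltr0n.
have nab : a + n%:R * ((b - a) / n%:R) = b by rewrite mulrC divfK ?gt_eqF// subrKC.
have := J_approx n a ((b - a) / n%:R) a0; rewrite nab divr_gt0// ?subr_gt0// => /(_ isT) h.
apply: le_trans h _; rewrite mulrAC ler_pdivrMr// -/C mulrC -ler_pdivrMr//.
apply: ltW; apply: lt_le_trans (archi_boundP _) _; first by rewrite divr_ge0// ltW.
by rewrite ler_nat.
Qed.

(** The slope may be unbounded near 0: monotone convergence handles the integral, right continuity
    of [m] at 0 the increments. *)
Lemma integral_right_slope (b : R) : 0 <= b ->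
  (\int[mu]_(x in `]0%R, b]) (r x)%:E = (m b - m 0)%:E)%E.
Proof.
rewrite le_eqVlt => /predU1P[<-|b0].
  by rewrite subrr set_itv_ge ?bnd_simp ?ltxx// integral_set0.
(* The [+ 2] keeps the left end below [b] already for [n = 0]. *)
pose F (n : nat) : set R := `]b / n.+2%:R, b]%classic.
have bn (n : nat) : 0 < b / n.+2%:R by rewrite divr_gt0.
have bnb (n : nat) : b / n.+2%:R < b by rewrite ltr_pdivrMr// ltr_pMr// ltr1n.
have UF : `]0, b]%classic = \bigcup_n F n.
  apply/seteqP; split => x /=; last first.
    by move=> [n _]; rewrite /F/= !in_itv/= => /andP[nx ->]; rewrite (lt_trans _ nx).
  rewrite in_itv/= => /andP[x0 xb].
  exists (Num.bound (b / x)) => //; rewrite /F/= in_itv/= xb andbT.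
  rewrite ltr_pdivrMr// mulrC -ltr_pdivrMr//.
  apply: lt_le_trans (archi_boundP _) _; first by rewrite divr_ge0// ltW.
  by rewrite ler_nat; exact: leqW.
have E n : (\int[mu]_(x in F n) (r x)%:E = (m b - m (b / n.+2%:R))%:E)%E.
  rewrite -(J_eq _ _ (bn n) (bnb n)) /J /Rintegral fineK//.
  by apply: integrable_fin_num; [exact: measurable_itv|exact: integrable_right_slope].
have c1 : (\int[mu]_(x in F n) (r x)%:E)%E @[n --> \oo] -->
    (\int[mu]_(x in `]0%R, b]) (r x)%:E)%E.
  rewrite UF; apply: ge0_nondecreasing_set_cvg_integral.
  - move=> i j ij; apply/subsetPset => x; rewrite /F/= !in_itv/= => /andP[ix ->].
    rewrite andbT (le_lt_trans _ ix)// ler_pM2l// lef_pV2 ?posrE// ler_nat.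
    by rewrite !ltnS.
  - by move=> i; exact: measurable_itv.
  - move=> i; apply/measurable_EFinP; exact: measurable_funS measurable_right_slope.
  - by move=> i x _; rewrite lee_fin right_slope_ge0.
have c2 : (\int[mu]_(x in F n) (r x)%:E)%E @[n --> \oo] --> (m b - m 0)%:E.
  under eq_fun do rewrite E.
  apply: cvg_EFin; first by exact: nearW.
  apply/cvgrPdist_lt => e e0.
  have [d d0 hd] := m_rc0 e e0.
  exists (Num.bound (b / d)) => // n /= bd.
  rewrite (_ : _ - _ = m (b / n.+2%:R) - m 0); last by ring.
  rewrite hd ?add0r// ?ltW// ltr_pdivrMr// mulrC -ltr_pdivrMr//.
  apply: lt_le_trans (archi_boundP _) _; first by rewrite divr_ge0// ltW.
  by rewrite ler_nat; exact/leqW/leqW.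
exact: cvg_unique c1 c2.
Qed.

End concave_density.

(** * From distribution functions to Borel sets *)

Section borel_extension.
Context {R : realType}.
Notation BR := (measurableTypeR R).

(** Finiteness on left half-lines permits subtraction, which yields agreement on the generating
    intervals []a, b]], and also supplies the sigma-finite exhaustion. *)
Lemma measure_cdf_unique (l1 l2 : {measure set BR -> \bar R}) :
  (forall x : R, l1 `]-oo, x]%classic = l2 `]-oo, x]%classic) ->
  (forall x : R, (l1 `]-oo, x]%classic < +oo)%E) ->
  forall A : set BR, measurable A -> l1 A = l2 A.
Proof.
move=> E fin A mA.
have mitv (i : interval R) : measurable ([set` i] : set BR) by exact: measurable_itv.
have split_ (l : {measure set BR -> \bar R}) (a b : R) : a <= b ->
    l `]-oo, b]%classic = (l `]-oo, a]%classic + l `]a, b]%classic)%E.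
  move=> ab; rewrite -measureU//.
    congr (l _); apply/seteqP; split => x /=; rewrite !in_itv/=.
      by have [xa|ax] := leP x a; [left|right].
    by move=> [/le_trans -> //|/andP[]].
  apply/seteqP; split => // x /=; rewrite !in_itv/= => -[xa /andP[ax _]].
  by move: (lt_le_trans ax xa); rewrite ltxx.
have cancel (a b c : \bar R) : a \is a fin_num -> (a + b = a + c)%E -> b = c.
  by case: a b c => [x| |] [y| |] [z| |] // _ [] /addrI ->.
have l12 (a b : R) : l1 `]a, b]%classic = l2 `]a, b]%classic.
  have [ab|ba] := leP a b; last first.
    by rewrite set_itv_ge ?measure0// bnd_simp -leNgt ltW.
  have := split_ l1 a b ab; rewrite E (split_ l2 a b ab) E.
  have fa : l2 `]-oo, a]%classic \is a fin_num by rewrite ge0_fin_numE// -E fin.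
  by move/(cancel _ _ _ fa) => ->.
apply: (@measure_unique _ R BR (@ocitv R)
  (fun k : nat => `](- k%:R)%R, k%:R]%classic : set BR) erefl _ _ _ l1 l2 _ _ A mA).
- exact: ocitvI.
- by move=> i; exact: is_ocitv.
- exact: bigcup_itvT.
- by move=> _ [[a b]] _ <-; exact: l12.
- move=> k; apply: le_lt_trans (fin k%:R); apply: le_measure; rewrite ?inE//.
  by move=> x /=; rewrite !in_itv/= => /andP[].
Qed.

End borel_extension.

Section density_extension.
Context {R : realType}.
Notation mu := (@lebesgue_measure R).
Notation BR := (measurableTypeR R).
Variables (lap lan : {finite_measure set BR -> \bar R}) (T : R) (m r : R -> R).
Hypothesis T0 : 0 <= T.
Hypothesis mE : forall y : R, 0 <= y -> y <= T -> m y = rcdf lap T y - rcdf lan T y.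
Hypotheses (m0 : 0 <= m 0) (r_ge0 : forall x : R, 0 <= r x) (mr : measurable_fun setT r).
Hypothesis int_r : forall b : R, 0 <= b ->
  (\int[mu]_(x in `]0%R, b]) (r x)%:E = (m b - m 0)%:E)%E.

(** With [lan] on the right, both sides are nonnegative measures once restricted to [[0, T]], so
    comparing distribution functions is enough. *)
Lemma density_extension (A : set BR) : measurable A -> A `<=` `[0, T] ->
  lap A = (lan A + ((m 0)%:E * dirac (0%R : BR) A +
    \int[mu]_(x in A `&` `]0%R, +oo[) (r x)%:E))%E.
Proof.
have mD : measurable (`[0, T]%classic : set BR) by exact: measurable_itv.
have mD0 : measurable (`]0, T]%classic : set BR) by exact: measurable_itv.
pose rT : BR -> \bar R := (EFin \o r) \_ `]0, T].
have rT_ge0 x : (0 <= rT x)%E by rewrite /rT patchE; case: ifP => _ //=; rewrite lee_fin.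
have irT : mu.-integrable setT rT.
  apply/(integrable_mkcond _ mD0)/integrableP; split.
    by apply/measurable_EFinP; exact: measurable_funS mr.
  under eq_integral do rewrite gee0_abs ?lee_fin//.
  by rewrite int_r// ltry.
have nu_ge0 (E : set BR) : (0 <= induced_charge irT E)%E.
  by rewrite /induced_charge; apply: integral_ge0.
pose nu : {measure set BR -> \bar R} := measure_of_charge (induced_charge irT) nu_ge0.
have nuE (E : set BR) : nu E = (\int[mu]_(x in E `&` `]0%R, T]) (r x)%:E)%E.
  by rewrite /nu /measure_of_charge /induced_charge [RHS]integral_mkcondr.
pose l1 : {measure set BR -> \bar R} := mrestr lap mD.
pose l2 : {measure set BR -> \bar R} :=
  measure_add (mrestr lan mD) (measure_add (mscale (NngNum m0) (dirac (0%R : BR))) nu).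
have l2E (E : set BR) : l2 E = (lan (E `&` `[0%R, T]) + ((m 0)%:E * dirac (0%R : BR) E +
    \int[mu]_(x in E `&` `]0%R, T]) (r x)%:E))%E.
  rewrite -nuE; transitivity (mrestr lan mD E +
      measure_add (mscale (NngNum m0) (dirac (0%R : BR))) nu E)%E.
    exact: measure_addE.
  by congr (_ + _)%E; exact: measure_addE.
have key : forall E : set BR, measurable E -> l1 E = l2 E.
  apply: measure_cdf_unique => x; last first.
    by rewrite /l1/= /mrestr -rcdfE ltry.
  rewrite l2E /l1/= /mrestr -!rcdfE diracE.
  have [x0|x0] := ltP x 0.
    rewrite !rcdf_neg// memNset/=; last by rewrite in_itv/=; apply/negP; rewrite -ltNge.
    rewrite mule0 !add0e (_ : _ `&` _ = set0) ?integral_set0//.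
    by apply/seteqP; split => // z /=; rewrite !in_itv/= => -[zx /andP[z0 _]]; lra.
  rewrite mem_set/= ?in_itv//= mule1.
  (* Everything restricted to [[0, T]] sees [x] only through [min x T], to which [mE] applies. *)
  have [y [y0 yT yx I]] : exists y : R, [/\ 0 <= y, y <= T,
      forall la : {finite_measure set BR -> \bar R}, rcdf la T x = rcdf la T y &
      `]-oo, x] `&` `]0, T] = `]0, y]%classic :> set R].
    exists (Num.min x T); split.
    - by rewrite le_min x0.
    - by rewrite ge_min lexx orbT.
    - move=> la; rewrite /rcdf; congr (fine (la _)); apply/seteqP; split => z /=;
        rewrite !in_itv/= le_min => -[h /andP[z0 zT]].
        by rewrite h z0 zT.
      by case/andP: h => -> _; rewrite z0 zT.
    - apply/seteqP; split => z /=; rewrite !in_itv/= le_min.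
        by move=> [-> /andP[-> ->]].
      by move=> /andP[-> /andP[-> ->]].
  rewrite !yx I int_r// -!EFinD mE//; congr (_%:E).
  by rewrite (mE y y0 yT); ring.
move=> mA AT; have := key A mA.
rewrite l2E /l1/= /mrestr (setIidl AT) => ->; congr (_ + (_ + _))%E.
congr (integral _ _ _); apply/seteqP; split => z /= [Az]; rewrite !in_itv/=.
  by move=> /andP[-> _].
by rewrite andbT => ->; have := AT z Az; rewrite /= in_itv/= => /andP[_ ->].
Qed.

End density_extension.

Lemma nonincreasing_locally_integrable {R : realType} (G : R -> R) :
  (forall t : R, 0 <= t -> 0 <= G t) ->
  (forall s t : R, 0 <= s -> s <= t -> G t <= G s) -> locally_integrable_on_nonneg G.
Proof.
move=> G0 Gni T T0; apply: measurable_bounded_integrable.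
- exact: measurable_itv.
- by rewrite /= lebesgue_measure_itv/=; case: ifP => _; rewrite ltry.
(* Composing with the maximum gives a function monotone on the whole line that agrees with [G] on
   [[0, T]]. *)
- have h : measurable_fun (`[0, T]%classic : set R) (fun u : R => G (Num.max u 0)).
    apply: nonincreasing_measurable => [|x y xy]; first exact: measurable_itv.
    apply: Gni; first by rewrite le_max lexx orbT.
    by rewrite ge_max !le_max xy lexx orbT.
  apply: eq_measurable_fun h => x; rewrite inE/= in_itv/= => /andP[x0 _].
  by rewrite max_l.
- exists (G 0); split; first by rewrite num_real.
  move=> B GB x /=; rewrite in_itv/= => /andP[x0 _].
  by rewrite ger0_norm ?G0// (le_trans _ (ltW GB))// Gni.
Qed.

(** * Density and monotonicity of the resolvent of a preserving kernel *)

Section resolvent_density.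
Context {R : realType}.
Notation mu := (@lebesgue_measure R).
Notation BR := (measurableTypeR R).
Variables (G : R -> R) (M : set R -> R).
Hypotheses (G_ge0 : forall t : R, 0 <= t -> 0 <= G t)
  (G_ni : forall s t : R, 0 <= s -> s <= t -> G t <= G s)
  (Grc : forall t : R, 0 <= t -> right_continuous_at G t)
  (G0 : 0 < G 0) (Gpres : preserves_nonnegativity G)
  (rM : resolvent_first_kind G M).

Lemma preserving_resolvent_density : exists r : R -> R,
  [/\ forall x, 0 <= r x, forall x : R, x <= 0 -> r x = 0,
      forall s t : R, 0 < s -> s <= t -> r t <= r s,
      measurable_fun setT r &
      (forall T : R, 0 < T -> mu.-integrable `]0, T] (EFin \o r)) /\
      forall A : set BR, measurable A -> A `<=` `[0, +oo[ -> bounded_set (A : set R) ->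
        ((M A)%:E = (G 0)^-1%:E * dirac (0%R : BR) A +
          \int[mu]_(s in A `&` `]0%R, +oo[) (r s)%:E)%E].
Proof.
have Gi := nonincreasing_locally_integrable _ G_ge0 G_ni.
(* Built from [M] itself and hence independent of [T], unlike the local distribution functions, with
   which it agrees on every window. The atom at 0 is entered by its known value. *)
pose m (y : R) := (G 0)^-1 + M `]0, y]%classic.
have mE (T : R) (lap lan : {finite_measure set BR -> \bar R}) :
    (forall A : set BR, measurable A -> A `<=` `[0, T] -> (M A)%:E = (lap A - lan A)%E) ->
    rcdf lap T 0 - rcdf lan T 0 = (G 0)^-1 ->
    forall y : R, 0 <= y -> y <= T -> m y = rcdf lap T y - rcdf lan T y.
  move=> MA m0 y y0 yT.
  by rewrite /m (cdfB_itv M T lap lan MA)// m0 addrC subrK.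
have local_ (T : R) : 0 < T -> exists m' : R -> R,
    [/\ forall y : R, 0 <= y -> y <= T + 1 -> m y = m' y,
        forall y, right_continuous_at m' y,
        forall a b : R, 0 <= a -> a <= b -> b < T -> m' a <= m' b &
        forall a b c : R, 0 <= a -> a < b -> b < c -> c < T ->
          (c - b) * m' a + (b - a) * m' c <= (c - a) * m' b].
  move=> T0; have T10 : 0 < T + 1 by lra.
  have [lap [lan [MA gm m0]]] := resolvent_cdf G M (T + 1) T10 G_ge0 G0 Gi rM.
  set m' := fun y => rcdf lap (T + 1) y - rcdf lan (T + 1) y in gm.
  have bm : bounded_measurable m' := cdfB_bounded_measurable (T + 1) lap lan.
  have m'rc : forall y, right_continuous_at m' y := cdfB_right_continuous (T + 1) lap lan.
  have m'n : forall y, y < 0 -> m' y = 0 := cdfB_neg (T + 1) lap lan.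
  exists m'; split => //.
  - exact: mE.
  - exact: (cdf_nondecreasing G m' T G_ni G0 Gpres Gi (Grc 0 (lexx _)) T0 bm m'rc m'n gm).
  - exact: (cdf_concave G m' T G_ni G0 Gpres Gi (Grc 0 (lexx _)) T0 bm m'rc m'n gm).
have m_nd (a b : R) : 0 <= a -> a <= b -> m a <= m b.
  move=> a0 ab; have T0 : 0 < b + 1 by lra.
  have [m' [E _ h _]] := local_ _ T0.
  by rewrite !E; try lra; apply: h => //; lra.
have m_concave (a b c : R) : 0 <= a -> a < b -> b < c ->
    (c - b) * m a + (b - a) * m c <= (c - a) * m b.
  move=> a0 ab bc; have T0 : 0 < c + 1 by lra.
  have [m' [E _ _ h]] := local_ _ T0.
  by rewrite !E; try lra; apply: h => //; lra.
have m_rc0 : right_continuous_at m 0.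
  have [m' [E h _ _]] := local_ 1 ltr01.
  move=> e e0; have [d d0 hd] := h 0 e e0; exists (Num.min d 1); first by rewrite lt_min d0 ltr01.
  move=> u u0; rewrite add0r lt_min => /andP[ud u1].
  by rewrite !E; try lra; apply: hd; lra.
have m0 : m 0 = (G 0)^-1.
  have [lap [lan [MA gm m0]]] := resolvent_cdf G M 1 ltr01 G_ge0 G0 Gi rM.
  by rewrite (mE _ _ _ MA m0).
have r0 := right_slope_ge0 m m_concave m_nd.
have mr := measurable_right_slope m m_concave.
have ri := integral_right_slope m m_concave m_nd m_rc0.
exists (right_slope m); split => //.
- by move=> x x0; rewrite /right_slope ltNge x0.
- exact: right_slope_ni.
split.
  move=> T T0; apply/integrableP; split.
    by apply/measurable_EFinP; exact: measurable_funS mr.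
  under eq_integral do rewrite gee0_abs ?lee_fin//.
  by rewrite ri ?ltry// ltW.
move=> A mA A0 [b [_ hb]].
(* [bounded_set] bounds [A] by every number above [b]; this one is positive as well. *)
pose T : R := `|b| + 1; have T0 : 0 < T by rewrite ltr_wpDl.
have AT : A `<=` `[0, T].
  move=> x Ax; have := A0 x Ax; rewrite /= !in_itv/= andbT => x0; rewrite x0/=.
  have bT : b < T by rewrite (le_lt_trans (ler_norm _))// ltrDl.
  by have : `|x : R| <= T := hb T bT x Ax; rewrite ger0_norm.
have [lap [lan [MA gm m0']]] := resolvent_cdf G M T T0 G_ge0 G0 Gi rM.
have c0 : 0 <= m 0 by rewrite m0 invr_ge0 ltW.
rewrite MA// (density_extension lap lan T m (right_slope m) (ltW T0) (mE _ _ _ MA m0') c0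
  r0 mr ri A mA AT).
by rewrite m0 [X in (X - _)%E]addeC addeK// fin_num_measure.
Qed.

Lemma measurable_shift_image (h : R) (A : set BR) :
  measurable A -> measurable [set h + a | a in A : set R].
Proof.
move=> mA; have := measurable_shift (- h) measurableT A mA; rewrite setTI.
congr measurable; apply/seteqP; split => x /=.
  by move=> Ax; exists (x - h) => //; rewrite subrKC.
by move=> [a Aa <-]; rewrite addrC addKr.
Qed.

(** A translate of [A] by [h >= 0] meets the atom only if [h = 0], and the density decreases
    pointwise. *)
Lemma preserving_resolvent_nonincreasing : nonincreasing_measure M.
Proof.
have [r [r0 rneg r_ni mr [_ MA]]] := preserving_resolvent_density.
move=> h1 h2 h10 h12 A mA A0 [b [_ hb]].
have mrs (c : R) : measurable_fun setT (fun s : R => r (c + s)).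
  by apply: measurableT_comp mr _; exact: measurable_funD.
(* Removing the null point 0 keeps [h + s] positive even for [h = 0]: the value of [r] at 0 is a
   default, and [r_ni] holds only beyond 0. *)
have F (h : R) : 0 <= h -> ((M [set (h + a)%R | a in A])%:E =
    (G 0)^-1%:E * (\1_A (- h)%R)%:E + \int[mu]_(s in A `\ 0%R) (r (h + s)%R)%:E)%E.
  move=> h0; rewrite MA; last 3 first.
  - exact: measurable_shift_image.
  - move=> _ [a /A0 + <-]; rewrite /= !in_itv/= !andbT => a0; exact: addr_ge0.
  - exists (h + `|b| + 1); split; first by rewrite num_real.
    move=> B hB _ [a Aa <-]; rewrite /= (le_trans (ler_normD _ _))// ger0_norm//.
    have b1 : b < `|b| + 1 by rewrite (le_lt_trans (ler_norm _))// ltrDl.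
    have : `|a : R| <= `|b| + 1 := hb _ b1 a Aa.
    by rewrite -(lerD2l h) addrA => /le_trans -> //; exact: ltW.
  congr (_ * _ + _)%E.
    rewrite diracE indicE; congr (nat_of_bool _)%:R%:E; apply/idP/idP; rewrite !inE/=.
      by move=> [a Aa ha]; rewrite (_ : - h = a)//; apply/eqP; rewrite eq_sym -addr_eq0 addrC ha.
    by move=> Ah; exists (- h) => //; rewrite subrr.
  have Z : (\int[mu]_(s in A `\ 0%R) (r (h + s)%R)%:E = \int[mu]_(s in A) (r (h + s)%R)%:E)%E.
    apply: integral_setD1; first exact: measurableD.
    by apply/measurable_EFinP; exact: measurable_funS (mrs h).
  rewrite Z integral_mkcond [RHS]integral_mkcond.
  rewrite -[LHS](ge0_integral_shift h).
  - apply: eq_integral => s _; rewrite !patchE.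
    rewrite in_setI.
    case: ifPn; case: ifPn => //=.
    + by rewrite addrC.
    + move=> sA /andP[]; rewrite inE/= => -[a Aa /eqP]; rewrite addrC (inj_eq (addIr _)) => /eqP E.
      by move: sA; rewrite notin_setE -E.
    + move=> sA; rewrite negb_and => /orP[|]; rewrite notin_setE/=.
        by case; exists s; [exact: set_mem|rewrite addrC].
      by rewrite in_itv/= andbT => /negP; rewrite -leNgt addrC => /rneg ->.
  - apply/(measurable_restrictT _ _).1; last first.
      by apply/measurable_EFinP; exact: measurable_funS mr.
    by apply: measurableI; [exact: measurable_shift_image|exact: measurable_itv].
  - by move=> x; rewrite patchE; case: ifP => //= _; rewrite lee_fin.
rewrite -lee_fin !F//; last exact: le_trans h12.
apply: leeD.
  apply: lee_pmul => //; rewrite ?lee_fin ?invr_ge0 ?(ltW G0)//.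
  rewrite !indicE; case: (boolP (- h2 \in A)) => // Ah2.
  have := A0 _ (set_mem Ah2); rewrite /= in_itv/= andbT oppr_ge0 => h20.
  have -> : h1 = h2 by apply/eqP; rewrite eq_le h12 (le_trans h20).
  by rewrite Ah2.
have mA' : measurable (A `\ 0%R : set BR) by exact: measurableD.
have mrs' (c : R) : measurable_fun (A `\ 0%R : set BR) (fun s : R => (r (c + s))%:E).
  by apply/measurable_EFinP; exact: measurable_funS (mrs c).
apply: ge0_le_integral => //.
  by move=> x _; rewrite lee_fin.
move=> x [/A0]; rewrite /= in_itv/= andbT => x0 xn0; rewrite lee_fin; apply: r_ni.
  by rewrite ltr_wpDl// lt_neqAle x0 eq_sym andbT; apply/eqP.
by rewrite lerD2r.
Qed.

End resolvent_density.

(** * Existence of the resolvent *)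

Lemma cvg_right_continuous_at {R : realType} (f : R -> R) (t : R) :
  right_continuous_at f t -> f s @[s --> t^'+] --> f t.
Proof.
move=> h; apply/cvgrPdist_lt => e e0; have [d d0 hd] := h e e0.
apply/nbhs_ballP; exists d => //= u; rewrite /ball/= => tud tu.
rewrite distrC; apply: hd; first exact: ltW.
by move: tud; rewrite distrC ger0_norm ?subr_ge0 ?ltW// ltrBlDl.
Qed.

Section resolvent_existence.
Context {R : realType}.
Notation BR := (measurableTypeR R).
Variable G : R -> R.
Hypotheses (G_ge0 : forall t : R, 0 <= t -> 0 <= G t)
  (G_ni : forall s t : R, 0 <= s -> s <= t -> G t <= G s)
  (Grc : forall t : R, 0 <= t -> right_continuous_at G t) (G0 : 0 < G 0).

(** Normalised to 1 at 0 and constant to the left, which makes it monotone, hence measurable, on the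
    whole line. *)
Let Gp (u : R) : R := G (Num.max u 0) / G 0.

Let Gp_ge0 u : 0 <= Gp u.
Proof. by rewrite /Gp divr_ge0 ?(ltW G0)// G_ge0// le_max lexx orbT. Qed.

Let Gp_le1 u : Gp u <= 1.
Proof. by rewrite /Gp ler_pdivrMr// mul1r G_ni// le_max lexx orbT. Qed.

Let Gp_ni (u v : R) : u <= v -> Gp v <= Gp u.
Proof.
move=> uv; rewrite /Gp ler_pM2r ?invr_gt0//; apply: G_ni; first by rewrite le_max lexx orbT.
by rewrite ge_max !le_max uv lexx orbT.
Qed.

Let mGp (t : R) : measurable_fun setT (fun s : R => Gp (t - s)).
Proof.
apply: measurableT_comp (measurable_reflect t).
by apply: nonincreasing_measurable => // x y; exact: Gp_ni.
Qed.

(** The Stieltjes measure of [- Gp]. The value [-1] of [F] on the negatives matches [- Gp 0], so 0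
    carries no mass. *)
Lemma jump_measure : exists la : {sigma_finite_measure set BR -> \bar R},
  forall y : R, la `]-oo, y]%classic = (if y < 0 then 0 else 1 - Gp y)%:E.
Proof.
pose F (y : R) : R := if y < 0 then -1 else - Gp y.
have Fnd : {homo F : x y / x <= y}.
  move=> x y xy; rewrite /F; have [x0|x0] := ltP x 0.
    by case: ifP => // _; rewrite lerN2.
  by rewrite ltNge (le_trans x0)//= lerN2 Gp_ni.
have Frc (x : R) : F s @[s --> x^'+] --> F x.
  apply: cvg_right_continuous_at => e e0; have [x0|x0] := ltP x 0.
    exists (- x); first by rewrite oppr_gt0.
    by move=> u xu; rewrite subrr => u0; rewrite /F u0 x0 subrr normr0.
  have eG : 0 < e * G 0 by rewrite mulr_gt0.
  have [d d0 hd] := Grc x x0 _ eG; exists d => // u xu ud.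
  have u0 : 0 <= u by exact: le_trans xu.
  rewrite /F (ltNge x 0) (ltNge u 0) x0 u0/= /Gp !max_l//.
  rewrite (_ : _ - _ = (G x - G u) / G 0); last by ring.
  rewrite normrM.
  by rewrite [X in _ * X]gtr0_norm ?invr_gt0// ltr_pdivrMr// distrC hd.
pose Fc : cumulative R R := HB.pack F (isCumulative.Build R _ R F Fnd Frc).
exists (lebesgue_stieltjes_measure Fc) => y.
have oc (a b : R) : a <= b ->
    lebesgue_stieltjes_measure Fc `]a, b]%classic = (F b - F a)%:E.
  move=> ab; transitivity (wlength Fc (`]a, b]%classic : set (ocitv_type R))).
    by apply: (measurable_mu_extE (wlength Fc)); exact: is_ocitv.
  by rewrite wlength_itv_bnd.
(* With [- N <= y], the intervals exhausting the half-line all have a negative left end below [y];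
   there [F] is [-1], so their measures are constant in [n]. *)
pose N := Num.bound `|y|.
have yN : - N%:R <= y.
  by rewrite lerNl (le_trans (ler_norm _))// normrN ltW// archi_boundP.
have E : `]-oo, y]%classic = \bigcup_n `](- (N + n)%N%:R - 1)%R, y]%classic :> set BR.
  apply/seteqP; split => x /=; last by move=> [n _]; rewrite /= !in_itv/= => /andP[].
  rewrite in_itv/= => xy; exists (Num.bound `|x|) => //=; rewrite in_itv/= xy andbT.
  have : - x < (Num.bound `|x|)%:R.
    by rewrite (le_lt_trans (ler_norm _))// normrN archi_boundP.
  by rewrite natrD; have : 0 <= N%:R :> R by []; lra.
have c1 : (lebesgue_stieltjes_measure Fc \o
    (fun n => `](- (N + n)%N%:R - 1)%R, y]%classic : set BR)) n @[n --> \oo] -->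
    lebesgue_stieltjes_measure Fc `]-oo, y]%classic.
  rewrite E; apply: nondecreasing_cvg_mu.
  - by move=> i; exact: measurable_itv.
  - by rewrite -E; exact: measurable_itv.
  - move=> i j ij; apply/subsetPset => x /=; rewrite !in_itv/= => /andP[ix ->].
    rewrite andbT (le_lt_trans _ ix)// lerD2r lerN2 ler_nat.
    by rewrite leq_add2l.
apply: (cvg_unique (@ereal_hausdorff R) c1).
rewrite (_ : _ \o _ = cst (if y < 0 then 0 else 1 - Gp y)%:E); first exact: cvg_cst.
apply/funext => n /=; rewrite oc.
  have n0 : - (N + n)%N%:R - 1 < 0 :> R.
    by rewrite subr_lt0 (le_lt_trans _ ltr01)// oppr_le0.
  by rewrite /F n0; case: ifP => _; congr _%:E; ring.
apply: le_trans yN; rewrite natrD.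
by have : 0 <= n%:R :> R by []; lra.
Qed.

(** The convolution of [nu] and [la], as the image of the product measure under addition. *)
Lemma renewal_step (la : {sigma_finite_measure set BR -> \bar R})
    (nu : {measure set BR -> \bar R}) :
  exists nu' : {measure set BR -> \bar R}, forall t : R,
    (nu' `]-oo, t]%classic = \int[nu]_s la `]-oo, (t - s)%R]%classic)%E.
Proof.
have mf : measurable_fun setT (fun z : BR * BR => (z.1 + z.2)%R : BR).
  exact: measurable_funD.
refine (ex_intro _ (pushforward (nu \x la)%E (fun z : BR * BR => (z.1 + z.2)%R : BR)
  : {measure set BR -> \bar R}) _).
move=> t; rewrite /= /pushforward /product_measure1/=.
apply: eq_integral => s _ /=; congr (la _).
by apply/seteqP; split => y; rewrite /xsection/= in_setE/= !in_itv/= lerBrDl.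
Unshelve. exact: mf.
Qed.

(** The convolution powers of [la]. Since [la] has mass [1 - Gp y] up to [y], the kernel and one
    more convolution with [la] together restore the mass of [nu n]; the additive form avoids
    subtracting infinite values. *)
Lemma renewal_measures : exists nu : nat -> {measure set BR -> \bar R},
  (forall A, nu 0%N A = dirac (0%R : BR) A) /\
  forall n (t : R), (\int[nu n]_(s in `]-oo, t]) (Gp (t - s)%R)%:E +
    nu n.+1 `]-oo, t]%classic = nu n `]-oo, t]%classic)%E.
Proof.
have [la laE] := jump_measure.
pose step nu := projT1 (cid (renewal_step la nu)).
have stepE nu (t : R) : (step nu `]-oo, t]%classic = \int[nu]_s la `]-oo, (t - s)%R]%classic)%E.
  by rewrite /step; case: cid.
pose nu n := iter n step (dirac (0%R : BR)).
exists nu; split => // n t.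
have mt : measurable (`]-oo, t]%classic : set BR) by exact: measurable_itv.
rewrite [nu n.+1 _]stepE.
rewrite (_ : \int[nu n]_s _ = \int[nu n]_(s in `]-oo, t]) (1 - Gp (t - s)%R)%:E)%E; last first.
  rewrite [RHS]integral_mkcond; apply: eq_integral => s _; rewrite laE patchE subr_lt0.
  case: ifPn => st; case: ifPn => //; rewrite ?notin_setE ?inE/= in_itv/= => h.
    by move: st; rewrite ltNge h.
  by move/negP: h; rewrite -ltNge; rewrite (negbTE st).
rewrite -ge0_integralD//.
- under eq_integral do rewrite -EFinD subrKC.
  by rewrite integral_cst// mul1e.
- by move=> s _; rewrite lee_fin.
- by apply/measurable_EFinP; exact: measurable_funS (mGp t).
- by move=> s _; rewrite lee_fin subr_ge0.
- apply/measurable_EFinP; apply: measurable_funB => //.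
  exact: measurable_funS (mGp t).
Qed.

(** Summing these identities and comparing with [U = nu 0 + sum_n nu n.+1], the series of [nu n.+1]
    cancels provided it is finite. The work therefore lies in the finiteness of [U] on left
    half-lines. *)
Lemma renewal_measure : exists U : {measure set BR -> \bar R},
  [/\ forall t : R, t < 0 -> U `]-oo, t]%classic = 0%E,
      forall t : R, (U `]-oo, t]%classic < +oo)%E &
      forall t : R, 0 <= t -> (\int[U]_(s in `]-oo, t]) (Gp (t - s)%R)%:E)%E = 1%E].
Proof.
have [nu [nu0 nuS]] := renewal_measures.
have mit (t : R) : measurable (`]-oo, t]%classic : set BR) by exact: measurable_itv.
have Gp0 (t s : R) : (0 <= (Gp (t - s))%:E)%E by rewrite lee_fin.
have I0 n (t : R) : (0 <= \int[nu n]_(s in `]-oo, t]) (Gp (t - s)%R)%:E)%E.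
  by apply: integral_ge0 => s _; exact: Gp0.
pose U : {measure set BR -> \bar R} := mseries nu 0.
have UE A : U A = (\sum_(0 <= n <oo) nu n A)%E by [].
have neg n (t : R) : t < 0 -> nu n `]-oo, t]%classic = 0%E.
  move=> t0; elim: n => [|n ih].
    rewrite nu0 diracE memNset//= in_itv/=; apply/negP.
    by rewrite -ltNge.
  apply/eqP; rewrite eq_le measure_ge0 andbT -ih -(nuS n t) leeDr//.
have tele N (t : R) : (\sum_(0 <= n < N) \int[nu n]_(s in `]-oo, t]) (Gp (t - s)%R)%:E +
    nu N `]-oo, t]%classic = nu 0%N `]-oo, t]%classic)%E.
  elim: N => [|N ih]; first by rewrite big_geq// add0e.
  by rewrite big_nat_recr//= -addeA nuS.
(* On windows of length d the kernel is at least 1/2, so the telescoping identity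
   bounds the U-mass of each window by 2. *)
have [d d0 hd] : exists2 d : R, 0 < d & forall u, u < d -> 1 / 2 <= Gp u.
  have G2 : 0 < G 0 / 2 by rewrite divr_gt0.
  have [d d0 hd] := Grc 0 (lexx _) _ G2; exists d => // u ud.
  rewrite /Gp ler_pdivlMr//.
  have : `|G (Num.max u 0) - G 0| < G 0 / 2.
    by apply: hd; rewrite ?le_max ?lexx ?orbT// add0r gt_max ud.
  by rewrite ltr_norml => /andP[h _]; lra.
have bin (t : R) : (U `](t - d)%R, t]%classic <= 2%:E)%E.
  have mI : measurable (`](t - d)%R, t]%classic : set BR) by exact: measurable_itv.
  rewrite UE; apply: lime_le; first by apply: is_cvg_nneseries.
  apply: nearW => N.
  apply: (@le_trans _ _ (\sum_(0 <= n < N) (2%:E *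
      \int[nu n]_(s in `]-oo, t]) (Gp (t - s)%R)%:E))%E).
    apply: lee_sum => n _.
    apply: (@le_trans _ _ (2%:E * \int[nu n]_(s in `](t - d)%R, t]) (1 / 2)%:E)%E).
      rewrite integral_cst// muleA -EFinM (_ : 2 * (1 / 2) = 1 :> R) ?mul1e//.
      by field.
    rewrite lee_wpmul2l//.
    apply: (@le_trans _ _ (\int[nu n]_(s in `](t - d)%R, t]) (Gp (t - s)%R)%:E)%E).
      apply: ge0_le_integral => //.
      - by apply/measurable_EFinP; exact: measurable_funS (mGp t).
      - move=> s /=; rewrite in_itv/= => /andP[ts _]; rewrite lee_fin; apply: hd.
        by rewrite ltrBlDl -ltrBlDr.
    apply: ge0_subset_integral => //.
      by apply/measurable_EFinP; exact: measurable_funS (mGp t).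
    by move=> s /=; rewrite !in_itv/= => /andP[].
  rewrite -ge0_sume_distrr//.
  rewrite -[leRHS]mule1 lee_wpmul2l//.
  apply: (@le_trans _ _ (nu 0%N `]-oo, t]%classic)).
    by rewrite -(tele N t) leeDl.
  by rewrite nu0 diracE; case: (_ \in _).
have Uneg (t : R) : t < 0 -> U `]-oo, t]%classic = 0%E.
  by move=> t0; rewrite UE eseries0// => n _ _; exact: neg.
(* Windows of length [d] are added one by one from [- d] on, up to which [U] has no mass. *)
have Ufin_grid k : (U `]-oo, (k%:R * d - d)%R]%classic < +oo)%E.
  elim: k => [|k ih]; first by rewrite Uneg ?ltry//; lra.
  have -> : `]-oo, (k.+1%:R * d - d)%R]%classic = `]-oo, (k%:R * d - d)%R] `|`
      `](k.+1%:R * d - d - d)%R, (k.+1%:R * d - d)%R] :> set BR.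
    have E1 : k.+1%:R * d - d - d = k%:R * d - d :> R by rewrite -natr1; ring.
    have E2 : k%:R * d - d <= k.+1%:R * d - d by rewrite -natr1; lra.
    rewrite E1; apply/seteqP; split => x /=; rewrite !in_itv/=.
      by move=> ->; have [|] := leP x (k%:R * d - d); [left|right].
    by move=> [/le_trans -> //|/andP[]].
  have /le_lt_trans -> // := measureU2 U (mit (k%:R * d - d))
    (measurable_itv `](k.+1%:R * d - d - d), (k.+1%:R * d - d)]).
  by rewrite lte_add_pinfty// (le_lt_trans (bin _))// ltry.
have Ufin (t : R) : (U `]-oo, t]%classic < +oo)%E.
  pose k := (Num.bound (t / d)).+1.
  apply: le_lt_trans (Ufin_grid k); apply: le_measure; rewrite ?inE//.
  move=> x /=; rewrite !in_itv/= => /le_trans; apply.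
  rewrite /k -natr1 mulrDl mul1r addrK -ler_pdivrMr//.
  have [t0|t0] := leP 0 t; first by rewrite ltW// archi_boundP// divr_ge0// ltW.
  apply: (@le_trans _ _ 0) => //; rewrite pmulr_lle0 ?invr_gt0//; exact: ltW.
exists U; split => // t t0.
rewrite ge0_integral_measure_series//; last first.
  by apply/measurable_EFinP; exact: measurable_funS (mGp t).
have S0 n : (0 <= nu n `]-oo, t]%classic)%E by [].
have : (U `]-oo, t]%classic = nu 0%N `]-oo, t]%classic +
    \sum_(0 <= n <oo) nu n.+1 `]-oo, t]%classic)%E.
  rewrite UE nneseries_recl//; congr (_ + _)%E.
  rewrite -(nneseries_addn 1)//; apply: eq_eseriesr => n _; by rewrite addn1.
have : (U `]-oo, t]%classic = \sum_(0 <= n <oo) \int[nu n]_(s in `]-oo, t]) (Gp (t - s)%R)%:E +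
    \sum_(0 <= n <oo) nu n.+1 `]-oo, t]%classic)%E.
  rewrite -nneseriesD//.
  by rewrite UE; apply: eq_eseriesr => n _; rewrite nuS.
have Ut := Ufin t.
have s0 : (0 <= \sum_(0 <= n <oo) nu n.+1 `]-oo, t]%classic)%E by exact: nneseries_ge0.
have -> : nu 0%N `]-oo, t]%classic = 1%E.
  by rewrite nu0 diracE mem_set//= in_itv/=.
move=> e1 e2.
have sfin : (\sum_(0 <= n <oo) nu n.+1 `]-oo, t]%classic)%E \is a fin_num.
  by rewrite ge0_fin_numE// (le_lt_trans _ Ut)// e2 leeDr.
have cancel (a b c : \bar R) : c \is a fin_num -> (a + c = b + c)%E -> a = b.
  by case: a b c => [x| |] [y| |] [z| |] // _ [] /addIr ->.
by apply: (cancel _ _ _ sfin); rewrite -e1.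
Qed.

End resolvent_existence.

(** For a nonnegative measure the whole space and the empty set form a Hahn decomposition, so the
    negative part vanishes. The charges are restrictions to [[0, t]], as [U] may be infinite. *)
Lemma measure_resolvent_first_kind {R : realType} (G : R -> R)
    (U : {measure set (measurableTypeR R) -> \bar R}) :
  (forall t, 0 <= t -> 0 <= G t) ->
  (forall t : R, (U `[0%R, t]%classic < +oo)%E) ->
  (forall t : R, measurable_fun `[0, t]%classic (fun s => G (t - s))) ->
  (forall t : R, 0 <= t ->
    (\int[U]_(s in `[0%R, t]) (G (t - s)%R)%:E)%E = 1%E) ->
  resolvent_first_kind G (fun A => fine (U A)).
Proof.
move=> G0 Ufin mG UG.
have mI (t : R) : measurable (`[0, t]%classic : set (measurableTypeR R)) by exact: measurable_itv.
pose nu t : {charge set (measurableTypeR R) -> \bar R} :=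
  charge_of_finite_measure (mfrestr (mI t) (Ufin t)).
have nuE t A : A `<=` `[0, t] -> nu t A = U A.
  by move=> At; rewrite /nu /charge_of_finite_measure/= /mfrestr /mrestr setIidl.
have agr t : agrees_with_charge (fun A => fine (U A)) (nu t) `[0, t].
  move=> A mA At; rewrite (nuE _ _ At) fineK// ge0_fin_numE//.
  by apply: le_lt_trans (Ufin t); apply: le_measure; rewrite ?inE.
split=> [T T0|t t0]; first by exists (nu T); exact: agr.
have hd : hahn_decomposition (nu t) setT set0.
  split; [|exact: negative_set0|exact: setU0|exact: setI0].
  by split=> [|A mA _]; [exact: measurableT|exact: measure_ge0].
exists (nu t), setT, set0, hd.
have posE A : measurable A -> A `<=` `[0, t] -> jordan_pos hd A = U A.
  by move=> mA At; rewrite jordan_posE cjordan_posE /crestr0 mem_set// /crestr setIT (nuE _ _ At).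
have negE A : measurable A -> A `<=` `[0, t] -> jordan_neg hd A = 0%E.
  move=> mA At; rewrite jordan_negE cjordan_negE /crestr0 mem_set// /crestr setI0.
  by rewrite charge0 oppe0.
have varE A : measurable A -> A `<=` `[0, t] -> charge_variation hd A = U A.
  by move=> mA At; rewrite /charge_variation/= posE// negE// adde0.
have g0 s : `[0, t]%classic s -> (0 <= (G (t - s))%:E)%E.
  by rewrite /= in_itv/= => /andP[_ st]; rewrite lee_fin G0// subr_ge0.
split; first exact: agr.
  apply/integrableP; split; first by apply/measurable_EFinP; exact: mG.
  rewrite (eq_measure_integral U).
    rewrite (eq_integral (fun s : measurableTypeR R => (G (t - s))%:E)) ?UG ?ltry// => s.
    by rewrite inE => /g0 h; rewrite gee0_abs.
  by move=> A mA At; exact: varE.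
have -> : Rintegral (jordan_pos hd) `[0, t] (fun s => G (t - s)) = 1.
  rewrite /Rintegral (eq_measure_integral U) ?UG// => A mA At; exact: posE.
have -> : Rintegral (jordan_neg hd) `[0, t] (fun s => G (t - s)) = 0.
  rewrite /Rintegral (eq_measure_integral mzero) ?integral_measure_zero//.
by rewrite subr0.
Qed.

Lemma nonincreasing_resolvent_exists {R : realType} (G : R -> R) :
  (forall t : R, 0 <= t -> 0 <= G t) ->
  (forall s t : R, 0 <= s -> s <= t -> G t <= G s) ->
  (forall t : R, 0 <= t -> right_continuous_at G t) -> 0 < G 0 ->
  exists M, resolvent_first_kind G M.
Proof.
move=> G_ge0 G_ni Grc G0.
have [U [Uneg Ufin UG]] := renewal_measure G G_ge0 G_ni Grc G0.
have c0 : 0 <= (G 0)^-1 by rewrite invr_ge0 ltW.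
(* The factor [1 / G 0] undoes the normalisation of the kernel. *)
pose V : {measure set (measurableTypeR R) -> \bar R} := mscale (NngNum c0) U.
have mI (t : R) : measurable (`[0, t]%classic : set (measurableTypeR R)) by exact: measurable_itv.
have mG (t : R) (D : set R) : measurable_fun D (fun s : R => G (Num.max (t - s) 0)).
  apply: (@measurable_funS _ _ _ _ setT) => //.
  apply: (measurableT_comp (f := fun u : R => G (Num.max u 0))) (measurable_reflect t).
  apply: nonincreasing_measurable => // x y xy.
  apply: G_ni; first by rewrite le_max lexx orbT.
  by rewrite ge_max !le_max xy lexx orbT.
have g_ge0 (t s : R) : (0 <= (G (Num.max (t - s) 0))%:E)%E.
  by rewrite lee_fin G_ge0// le_max lexx orbT.
have GE (t : R) : {in `[0, t]%classic, (fun s : R => G (t - s)) =1 (fun s => G (Num.max (t - s) 0))}.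
  by move=> s; rewrite inE/= in_itv/= => /andP[_ st]; rewrite max_l// subr_ge0.
exists (fun A => fine (V A)); apply: measure_resolvent_first_kind => //.
- move=> t; rewrite /V /= /mscale/= lte_mul_pinfty// ?lee_fin//.
  apply: le_lt_trans (Ufin t); apply: le_measure; rewrite ?inE//.
  by move=> s /=; rewrite !in_itv/= => /andP[].
- by move=> t; apply: eq_measurable_fun (mG t _) => s /GE ->.
- move=> t t0.
  (* The renewal equation integrates over []-oo, t]], the resolvent equation over [[0, t]]; the open
     half-line between them is a countable union of closed null ones. *)
  have UN : U `]-oo, 0%R[%classic = 0%E.
    apply/negligibleP; first exact: measurable_itv.
    have sub : `]-oo, 0%R[ `<=` \bigcup_k (`]-oo, - k.+1%:R^-1]%classic : set (measurableTypeR R)).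
      move=> x /=; rewrite in_itv/= => /ltr_add_invr[k xk]; exists k => //=.
      by rewrite in_itv/= -subr_ge0 addrC -opprD oppr_ge0 ltW.
    have [k|B [mB UB BB]] := negligible_bigcup (mu := U) (F := fun k => `]-oo, - k.+1%:R^-1]%classic).
      apply/negligibleP; first exact: measurable_itv.
      by apply: Uneg; rewrite oppr_lt0 invr_gt0.
    by exists B; split=> //; exact: subset_trans sub BB.
  rewrite (eq_integral (fun s : measurableTypeR R => (G (Num.max (t - s) 0))%:E)); last first.
    by move=> s /GE ->.
  rewrite ge0_integral_mscale//=; last by apply/measurable_EFinP; exact: mG.
  rewrite -ge0_integralZl_EFin//; last by apply/measurable_EFinP; exact: mG.
  rewrite -[RHS](UG t t0).
  rewrite (_ : `]-oo, t]%classic = `]-oo, 0%R[ `|` `[0%R, t] :> set (measurableTypeR R)); last first.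
    apply/seteqP; split => x /=; rewrite !in_itv/=.
      by move=> ->; have [_|_] := leP 0 x; [right|left].
    by move=> [/ltW /le_trans ->//|/andP[]].
  have gm D : measurable_fun D (fun s : R => (G (Num.max (t - s) 0) / G 0)%:E).
    by apply/measurable_EFinP; apply: measurable_funM => //; exact: mG.
  rewrite ge0_integral_setU//=.
  - rewrite [X in _ = (X + _)%E]null_set_integral ?add0e//; last exact: gm.
    by apply: eq_integral => s _; rewrite -EFinM mulrC.
  - exact: gm.
  - by move=> s _; rewrite lee_fin divr_ge0 ?(ltW G0)// -lee_fin.
  - by apply/disj_set2P; rewrite -subset0 => s [] /=; rewrite !in_itv/= => + /andP[]; rewrite ltNge => /negP.
Qed.
Theorem theorem2p17 (R : realType) (G : R -> R)
    (G_ge0 : forall t, 0 <= t -> 0 <= G t)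
    (G_right_continuous : forall t, 0 <= t -> G s @[s --> t^'+] --> G t)
    (G0_gt0 : 0 < G 0) :
  (locally_integrable_on_nonneg G ->
   forall M : set R -> R, resolvent_first_kind G M ->
     nonincreasing_measure M -> preserves_nonnegativity G)
  /\
  ((forall s t, 0 <= s -> s <= t -> G t <= G s) ->
   (exists M : set R -> R, resolvent_first_kind G M)
   /\
   (forall M : set R -> R, resolvent_first_kind G M ->
      (preserves_nonnegativity G <-> nonincreasing_measure M)
      /\
      (preserves_nonnegativity G ->
         dirac_plus_nonincreasing_density (G 0)^-1 M))).
Proof.
have Grc t : 0 <= t -> right_continuous_at G t.
  by move=> t0; apply: right_continuous_at_cvg; exact: G_right_continuous.
have part1 := nonincreasing_resolvent_preserves_nonnegativity.
split=> [Gi M rM Mni|G_ni]; first exact: part1 Gi rM Mni.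
split=> [|M rM]; first exact: nonincreasing_resolvent_exists.
have Gi := nonincreasing_locally_integrable _ G_ge0 G_ni.
split=> [|Gpres].
  split=> [Gpres|Mni]; last exact: part1 Gi rM Mni.
  exact: preserving_resolvent_nonincreasing rM.
have [r [r_ge0 _ r_ni _ [ri rM']]] :=
  preserving_resolvent_density _ _ G_ge0 G_ni Grc G0_gt0 Gpres rM.
by exists r; split.
Qed.
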